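(* Let $d\ge1$ and let $\Lambda=\{\lambda_1,\dots,\lambda_d\}\subset\mathbf{R}$ be a set of $d$ distinct real numbers. Let $\mathcal{T}^\Lambda$ be the set of $d\times d$ real symmetric tridiagonal matrices with spectrum $\Lambda$ (with the Euclidean topology). Then $\overline{P}_d=(P_d\times\mathcal{E})/\!\sim$ is a polyhedral complex over $\mathcal{T}^\Lambda$; that is, the map $\widetilde{g}:\overline{P}_d\to\mathcal{T}^\Lambda$, $\widetilde g([(p,\varepsilon)])=g(p,\varepsilon)$, is a homeomorphism.
   Context: Write $[d]=\{1,\dots,d\}$. Coordinates. For non-empty $S\subseteq[d]$, $W^S=\{w:S\to\mathbf{R}\mid w\ne 0\}/\!\sim$ is the real projective space of non-zero maps modulo non-zero real scaling, and $W_+^S=\{w\in W^S\mid w_mw_n>0\ \forall m,n\in S\}$. $\mathcal{P}_{[d]}$ is the set of ordered partitions of $[d]$: sequences $(S_1,\dots,S_r)$ of non-empty pairwise disjoint sets with union $[d]$. $W_+^{(S_1,\dots,S_r)}=W_+^{S_1}\times\cdots\times W_+^{S_r}$, elements written $w^{S_1}\oplus\cdots\oplus w^{S_r}$; $\overline{\mathcal{D}}^\Lambda$ is the disjoint union of these over $\mathcal{P}_{[d]}$. $(R_1,\dots,R_q)\preceq(S_1,\dots,S_r)$ means that $(R_1,\dots,R_q)$ is a concatenation of ordered partitions of $S_1$, of $S_2$, ..., of $S_r$, in this order. The map $\overline f$. For non-empty $S\subseteq[d]$, $m=|S|$, $w\in W_+^S$, put $\langle p,q\rangle=\sum_{n\in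 S}w_np(\lambda_n)q(\lambda_n)$. Set $p_0=1$, $a_1=\langle1,\lambda\rangle/\langle1,1\rangle$, $p_1(\lambda)=\lambda-a_1$, and for $1\le n\le m-1$, $a_{2n}=\sqrt{\langle p_n,p_n\rangle/\langle p_{n-1},p_{n-1}\rangle}$, $a_{2n+1}=\langle p_n,\lambda p_n\rangle/\langle p_n,p_n\rangle$, $p_{n+1}(\lambda)=(\lambda-a_{2n+1})p_n(\lambda)-a_{2n}^2p_{n-1}(\lambda)$. $f(w)$ is the $m\times m$ symmetric tridiagonal matrix with diagonal $a_1,a_3,\dots,a_{2m-1}$ and next-to-diagonal entries $a_2,a_4,\dots,a_{2m-2}$. $\overline f(w^{S_1}\oplus\cdots\oplus w^{S_r})=f(w^{S_1})\oplus\cdots\oplus f(w^{S_r})$ (block diagonal). $\mathcal{B}^\Lambda$ and $\pi$. Let $C_i^S=\prod_{n\in S}(\lambda_n-\lambda_i)^2$, $C_i^\emptyset=1$, and $\mathcal{W}=\prod_{\emptyset\ne S\subseteq[d]}W^S$. $\mathcal{B}^\Lambda$ is the set of $w\in\mathcal{W}$ with $C_i^{S-R}w_j^Rw_i^S=C_j^{S-R}w_i^Rw_j^S$ for all non-empty $R\subseteq S\subseteq[d]$, $i,j\in R$, and $w_i^Sw_j^S\ge0$ for all non-empty $S\subseteq[d]$, $i,j\in S$. For $w\in\mathcal{B}^\Lambda$, $n\in[d]$, let $\varphi_w(n)$ be the unique $S\ni n$ of maximal cardinality with $w_n^S\ne0$; the range of $\varphi_w$ is a chain $[d]=K_1\supset\cdots\supset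 K_r\ne\emptyset$; with $(S_1,\dots,S_r)=(K_1-K_2,\dots,K_{r-1}-K_r,K_r)$ put $\pi(w)=(w_n^{K_1})_{n\in S_1}\oplus\cdots\oplus(w_n^{K_r})_{n\in S_r}\in W_+^{(S_1,\dots,S_r)}$. The map $\pi:\mathcal{B}^\Lambda\to\overline{\mathcal{D}}^\Lambda$ is a bijection. The faces of $\mathcal{B}^\Lambda$ are $\mathcal{B}^\Lambda_{(S_1,\dots,S_r)}=\mathrm{cl}(\pi^{-1}(W_+^{(S_1,\dots,S_r)}))$. Permutahedron. $\mathrm{Sym}[d]$ is the group of permutations of $[d]$, each $\sigma$ identified with the point $(\sigma(1),\dots,\sigma(d))\in\mathbf{R}^d$; $P_d$ is the convex hull of these points; $\widehat F$ denotes the convex hull of $F$. For $R\subseteq[d]$, $\mathrm{Sym}(R)\le\mathrm{Sym}[d]$ is the subgroup fixing every element of $[d]-R$. $\mathcal{G}$ is the collection of subgroups $\mathrm{Sym}(R_1)\times\cdots\times\mathrm{Sym}(R_q)$ with $(\{1\},\dots,\{d\})\preceq(R_1,\dots,R_q)\in\mathcal{P}_{[d]}$ (so the $R_j$ are consecutive intervals). The faces of $P_d$ are exactly the sets $\widehat F$ with $F=G\sigma$ a right coset, $G\in\mathcal{G}$, $\sigma\in\mathrm{Sym}[d]$. For such $F=G\sigma$ with $G=\mathrm{Sym}(R_1)\times\cdots\times\mathrm{Sym}(R_q)$, where $(\{1\},\dots,\{d\})\preceq(R_1,\dots,R_q)\in\mathcal{P}_{[d]}$, $\varphi(F)=(\sigma^{-1}(R_1),\dots,\sigma^{-1}(R_q))\in\mathcal{P}_{[d]}$.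 Fixed throughout is a homeomorphism $h:P_d\to\mathcal{B}^\Lambda$ with $h(\widehat F)=\mathcal{B}^\Lambda_{\varphi(F)}$ for every face $\widehat F$ of $P_d$ (such $h$ exists). The complex. For $p\in P_d$ let $J_p=\overline f\circ\pi\circ h(p)$. $\mathcal{E}$ is the (discrete) set of maps $\varepsilon:[d]\to\{+1,-1\}$. For $(p,\varepsilon)\in P_d\times\mathcal{E}$, $g(p,\varepsilon)=\mathrm{diag}(\varepsilon)J_p\,\mathrm{diag}(\varepsilon)$; $(p,\varepsilon)\sim(p',\varepsilon')$ iff $g(p,\varepsilon)=g(p',\varepsilon')$; $\overline{P}_d$ is the quotient space, and its faces are the images of the sets $\widehat F\times\{\varepsilon\}$. *)

(* Defs.v *)
From HB Require Import structures.
From mathcomp Require Import all_boot all_order all_fingroup all_algebra.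
From mathcomp Require Import generic_quotient.
From mathcomp Require Import all_classical all_reals all_analysis.

Set Implicit Arguments.
Unset Strict Implicit.
Unset Printing Implicit Defensive.

Import Order.TTheory GRing.Theory Num.Theory.
Import numFieldNormedType.Exports.

Local Open Scope ring_scope.
Local Open Scope quotient_scope.

Definition homeomorphism (X Y : topologicalType) (f : X -> Y) : Prop :=
  continuous f /\
  exists g : Y -> X, [/\ cancel f g, cancel g f & continuous g].

Definition is_ordpart (d : nat) (A : {set 'I_d}) (s : seq {set 'I_d}) : bool :=
  [&& finset.set0 \notin s,
      pairwise (fun B C : {set 'I_d} => [disjoint B & C]) s
    & (\bigcup_(B <- s) B)%SET == A].

(* \mathcal{P}_{[d]}; [d] is encoded as {0, ..., d-1} *)
Definition ordpart (d : nat) := {s : seq {set 'I_d} | is_ordpart finset.setT s}.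

(* r is finer than s *)
Definition preceq (d : nat) (r s : seq {set 'I_d}) : Prop :=
  exists rs : seq (seq {set 'I_d}),
    r = flatten rs /\ all2 (@is_ordpart d) s rs.

Section Projective.
Context {R : realType} {d : nat}.
Implicit Types S : {set 'I_d}.

Definition vecs S := prod_topology (fun _ : {i : 'I_d | i \in S} => R).

Definition nonzero_vecs S : set (vecs S) := (fun w => exists i, w i != 0).

Definition scaling S : rel (set_type (@nonzero_vecs S)) := fun u v =>
  `[< exists2 c : R, c != 0 & forall i, val u i = c * val v i >].

Lemma scaling_equiv S : equiv_class_of (@scaling S).
Proof.
split.
- by move=> u; apply/asboolP; exists 1; rewrite ?oner_neq0// => i; rewrite mul1r.
- move=> u v; apply/idP/idP => /asboolP[c c0 uv]; apply/asboolP;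
    by exists c^-1; rewrite ?invr_eq0// => i; rewrite uv mulKf.
- move=> v u w /asboolP[c c0 uv] /asboolP[e e0 vw]; apply/asboolP.
  by exists (c * e); rewrite ?mulf_neq0// => i; rewrite uv vw mulrA.
Qed.

Canonical scaling_equivRel S := EquivRelPack (@scaling_equiv S).

Definition W S : topologicalType :=
  quotient_topology {eq_quot (scaling_equivRel S)}.

(* Coordinate n of a chosen representative of w, extended by 0 outside S.
   All uses below are homogeneous in each point of a projective space. *)
Definition coord S (w : W S) (n : 'I_d) : R :=
  oapp (val (repr w)) 0 (insub n).

Lemma mkW_subproof S (u : 'I_d -> R) :
  (exists2 n, n \in S & u n != 0) ->
  (fun i : {i : 'I_d | i \in S} => u (val i)) \in @nonzero_vecs S.
Proof. by case=> n nS un; apply/mem_set; exists (exist _ n nS). Qed.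

Definition mkW S (u : 'I_d -> R) (hu : exists2 n, n \in S & u n != 0) : W S :=
  \pi_(W S) (exist (fun v => v \in @nonzero_vecs S) _ (mkW_subproof hu)).

Lemma coord_mkW S (u : 'I_d -> R) (hu : exists2 n, n \in S & u n != 0) :
  exists2 c : R, c != 0 & forall n, n \in S -> coord (mkW hu) n = c * u n.
Proof.
have : scaling (repr (mkW hu))
    (exist (fun v => v \in @nonzero_vecs S) _ (mkW_subproof hu)).
  by apply/eqmodP; rewrite -/(W S) reprK.
move=> /asboolP[c c0 hc]; exists c => // n nS.
by rewrite /coord insubT /= hc.
Qed.

Definition Wplus S :=
  {w : W S | `[< forall m n, m \in S -> n \in S -> 0 < coord w m * coord w n >]}.

(* \overline{\mathcal{D}}^\Lambda *)
Definition Dbar :=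
  {s : ordpart d &
    forall i : 'I_(size (val s)), Wplus (nth finset.set0 (val s) i)}.

(* \mathcal{W} *)
Definition Wprod : topologicalType :=
  prod_topology (fun S : {S : {set 'I_d} | S != finset.set0} => W (val S)).

(* w_n^S, equal to 0 when S is empty or n is not in S *)
Definition wcoord (w : Wprod) S (n : 'I_d) : R :=
  oapp (fun S' : {S : {set 'I_d} | S != finset.set0} => coord (w S') n)
    0 (insub S).

(* [set n] always satisfies the condition. On BLam below the maximiser is unique:
   by phi_max it contains every admissible S. *)
Definition phi (w : Wprod) (n : 'I_d) : {set 'I_d} :=
  [arg max_(S > [set n]%SET | (n \in S) && (wcoord w S n != 0%R)) #|S|]%N.

(* The range K_1, ..., K_r of phi in decreasing order; on BLam it is a chain by
   phi_total, so sorting by cardinality sorts by inclusion. *)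
Definition chain (w : Wprod) : seq {set 'I_d} :=
  sort (fun A B : {set 'I_d} => #|B| <= #|A|)%N
    (undup [seq phi w n | n <- enum 'I_d]).

(* The sequence K_1 - K_2, ..., K_{r-1} - K_r, K_r *)
Definition blocks (w : Wprod) : seq {set 'I_d} :=
  [seq (nth finset.set0 (chain w) k :\: nth finset.set0 (chain w) k.+1)%SET
     | k <- iota 0 (size (chain w))].

End Projective.

Arguments W R {d} S.
Arguments Wplus R {d} S.
Arguments Dbar R d : clear implicits.
Arguments Wprod R d : clear implicits.

Section Compactification.
Context {R : realType} {d : nat} (lam : 'I_d -> R).
Implicit Types Q S : {set 'I_d}.

Definition Ccoef (i : 'I_d) S : R := \prod_(n in S) (lam n - lam i) ^+ 2.

Definition BLam : set (Wprod R d) := (fun w =>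
  (forall Q S, Q != finset.set0 -> Q \subset S -> forall i j, i \in Q -> j \in Q ->
     Ccoef i (S :\: Q)%SET * wcoord w Q j * wcoord w S i =
     Ccoef j (S :\: Q)%SET * wcoord w Q i * wcoord w S j) /\
  (forall S, S != finset.set0 -> forall i j, i \in S -> j \in S ->
     0 <= wcoord w S i * wcoord w S j)).

Lemma coordP S (w : W R S) : exists2 n, n \in S & coord w n != 0.
Proof.
have /set_mem[[n nS] wn] := valP (repr w).
by exists n => //; rewrite /coord insubT.
Qed.

Lemma wcoordP (w : Wprod R d) S :
  S != finset.set0 -> exists2 n, n \in S & wcoord w S n != 0.
Proof.
move=> S0; have [n nS wn] := coordP (w (exist _ S S0)).
by exists n => //; rewrite /wcoord insubT.
Qed.

Lemma wcoord_out (w : Wprod R d) S n : n \notin S -> wcoord w S n = 0.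
Proof.
move=> nS; rewrite /wcoord; case: insubP => //= S' _ eS.
by rewrite /coord insubF //; apply/negbTE; rewrite eS.
Qed.

Lemma set1_neq0 (n : 'I_d) : [set n]%SET != finset.set0.
Proof. by apply/set0Pn; exists n; rewrite inE. Qed.

Lemma phiP (w : Wprod R d) n :
  [/\ n \in phi w n, wcoord w (phi w n) n != 0 &
      forall S, n \in S -> wcoord w S n != 0 -> (#|S| <= #|phi w n|)%N].
Proof.
rewrite /phi; case: arg_maxnP => [|S /andP[nS wS] Smax]; last first.
  by split=> // T nT wT; apply: Smax; rewrite nT.
have [m] := @wcoordP w [set n]%SET (set1_neq0 n).
by rewrite !inE eqxx => /eqP ->.
Qed.

Context (lam_inj : injective lam).

Lemma Ccoef_neq0 i S : i \notin S -> Ccoef i S != 0.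
Proof.
move=> iS; apply/prodf_neq0 => n nS; rewrite expf_neq0// subr_eq0.
by apply: contraNneq iS => /lam_inj <-.
Qed.

Context (w : Wprod R d) (Bw : BLam w).

Lemma wcoord_spread Q S i j : Q \subset S -> i \in Q -> j \in Q ->
  wcoord w S i != 0 -> wcoord w Q j != 0 -> wcoord w S j != 0.
Proof.
move=> QS iQ jQ wSi wQj.
have Q0 : Q != finset.set0 by apply/set0Pn; exists i.
have E := Bw.1 Q S Q0 QS i j iQ jQ.
apply: contra_neq wSi => wSj; move: E; rewrite wSj mulr0 => /eqP.
by rewrite !mulf_eq0 (negbTE wQj) (negbTE (Ccoef_neq0 _)) ?inE ?iQ//= => /eqP.
Qed.

Lemma phi_max n S : n \in S -> wcoord w S n != 0 -> S \subset phi w n.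
Proof.
move=> nS wSn; have [nP wPn max] := phiP w n.
have U0 : (S :|: phi w n)%SET != finset.set0.
  by apply/set0Pn; exists n; rewrite inE nS.
have [m mU wUm] := wcoordP w U0.
have wUn : wcoord w (S :|: phi w n)%SET n != 0.
  move: mU; rewrite inE => /orP[mS|mP].
    exact: (wcoord_spread (finset.subsetUl _ _) mS nS).
  exact: (wcoord_spread (finset.subsetUr _ _) mP nP).
have le : (#|(S :|: phi w n)%SET| <= #|phi w n|)%N.
  by apply: max => //; rewrite inE nS.
have /eqP -> : phi w n == (S :|: phi w n)%SET.
  by rewrite eqEcard finset.subsetUr le.
exact: finset.subsetUl.
Qed.

Lemma phi_total i j : (phi w i \subset phi w j) || (phi w j \subset phi w i).
Proof.
have [iP wi _] := phiP w i; have [jP wj _] := phiP w j.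
have U0 : (phi w i :|: phi w j)%SET != finset.set0.
  by apply/set0Pn; exists i; rewrite inE iP.
have [m mU wUm] := wcoordP w U0; move: (mU); rewrite inE => /orP[mi|mj].
  have wUi := wcoord_spread (finset.subsetUl _ _) mi iP wUm wi.
  have := phi_max _ wUi; rewrite inE iP => /(_ isT).
  by rewrite finset.subUset => /andP[_ ->]; rewrite orbT.
have wUj := wcoord_spread (finset.subsetUr _ _) mj jP wUm wj.
have := phi_max _ wUj; rewrite inE jP orbT => /(_ isT).
by rewrite finset.subUset => /andP[-> _].
Qed.

Lemma phi_sub m n : n \in phi w m -> phi w m \subset phi w n ->
  phi w n = phi w m.
Proof.
move=> nm mn; apply/eqP; rewrite finset.eqEsubset mn andbT.
have [mP wm _] := phiP w m; have [nP wn _] := phiP w n.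
apply: phi_max; first exact: (fintype.subsetP mn).
exact: (wcoord_spread mn nm mP).
Qed.

Local Notation K := (nth finset.set0 (chain w)).

Lemma mem_chain A : reflect (exists n, A = phi w n) (A \in chain w).
Proof.
rewrite mem_sort mem_undup; apply: (iffP mapP) => [[n _ ->]|[n ->]].
  by exists n.
by exists n => //; rewrite mem_enum.
Qed.

Lemma chain_sub i j : (i <= j)%N -> K j \subset K i.
Proof.
move=> ij; case: (ltnP j (size (chain w))) => jr; last first.
  by rewrite [K j]nth_default ?finset.sub0set.
have ir := leq_ltn_trans ij jr.
have /mem_chain[m Em] := mem_nth finset.set0 ir.
have /mem_chain[n En] := mem_nth finset.set0 jr.
have le : (#|K j| <= #|K i|)%N.
  pose leK (A B : {set 'I_d}) := (#|B| <= #|A|)%N.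
  apply: (@sorted_leq_nth _ leK _ _ finset.set0 (chain w)) => //.
  - by move=> B A C AB BC; apply: leq_trans BC AB.
  - by move=> A; rewrite /leK.
  - by apply: sort_sorted => A B; exact: leq_total.
have /orP[] := phi_total m n; rewrite -Em -En // => sub.
by have /eqP -> : K i == K j by rewrite eqEcard sub le.
Qed.

Lemma chain_proper i j : (i < j)%N -> (i < size (chain w))%N ->
  exists2 n, n \in K i & n \notin K j.
Proof.
move=> ij ir; apply/subsetPn; apply/negP => sub.
have EK : K i = K j.
  by apply/eqP; rewrite finset.eqEsubset sub chain_sub// ltnW.
have [jr|jr] := ltnP j (size (chain w)).
  have := nth_uniq finset.set0 ir jr; rewrite EK eqxx sort_uniq undup_uniq.
  by move=> /(_ isT) /esym/eqP E; rewrite E ltnn in ij.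
have /mem_chain[n En] := mem_nth finset.set0 ir.
by have [+ _ _] := phiP w n; rewrite -En EK nth_default// inE.
Qed.

Lemma size_blocks : size (blocks w) = size (chain w).
Proof. by rewrite size_map size_iota. Qed.

Lemma nth_blocks i : nth finset.set0 (blocks w) i = (K i :\: K i.+1)%SET.
Proof.
have [ir|ir] := ltnP i (size (chain w)).
  by rewrite (nth_map 0%N) ?size_iota// nth_iota// add0n.
by rewrite !nth_default ?size_blocks ?(leqW ir)// finset.set0D.
Qed.

Lemma blocks_phi i n : n \in nth finset.set0 (blocks w) i -> phi w n = K i.
Proof.
rewrite nth_blocks inE => /andP[nK1 nK].
have [ir|ir] := ltnP i (size (chain w)); last first.
  by move: nK; rewrite nth_default// inE.
have /mem_chain[m Em] := mem_nth finset.set0 ir.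
have /(nthP finset.set0)[j jr Ej] : phi w n \in chain w by apply/mem_chain; exists n.
have [nP _ _] := phiP w n.
have ji : (j <= i)%N.
  rewrite leqNgt; apply: contra nK1 => /chain_sub /fintype.subsetP; apply.
  by rewrite Ej.
by rewrite Em; apply: phi_sub; rewrite -Em// -Ej; exact: chain_sub.
Qed.

Lemma blocks_neq0 i : (i < size (blocks w))%N ->
  exists2 n, n \in nth finset.set0 (blocks w) i & wcoord w (K i) n != 0.
Proof.
rewrite size_blocks => ir; have [n nK nK1] := chain_proper (ltnSn i) ir.
have nB : n \in nth finset.set0 (blocks w) i by rewrite nth_blocks inE nK1.
by exists n => //; rewrite -(blocks_phi nB); case: (phiP w n).
Qed.

Lemma blocks_ordpart : is_ordpart finset.setT (blocks w).
Proof.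
apply/and3P; split.
- apply/negP => /(nthP finset.set0)[i /blocks_neq0[n nB _] E].
  by rewrite E inE in nB.
- apply/(pairwiseP finset.set0) => i j; rewrite !inE => ir jr ij.
  rewrite -setI_eq0; apply/eqP/setP => n; rewrite !inE !nth_blocks !inE.
  apply/negP => /andP[/andP[/negP ni _] /andP[_ nj]]; apply: ni.
  by move/fintype.subsetP: (chain_sub ij); apply.
- apply/eqP/setP => n; rewrite [RHS]inE.
  have /(nthP finset.set0)[j jr Ej] : phi w n \in chain w by apply/mem_chain; exists n.
  have [nP _ _] := phiP w n.
  suff nB : n \in nth finset.set0 (blocks w) j.
    rewrite finset.bigcup_seq; apply/finset.bigcupP; exists (nth finset.set0 (blocks w) j) => //.
    by rewrite mem_nth// size_blocks.
  rewrite nth_blocks inE Ej nP andbT; apply/negP => nK1.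
  have [jr1|jr1] := ltnP j.+1 (size (chain w)); last first.
    by rewrite nth_default ?inE in nK1.
  have /mem_chain[m Em] := mem_nth finset.set0 jr1.
  have := @phi_sub m n; rewrite -Em -Ej => /(_ nK1 (chain_sub (leqnSn j))) E.
  by have [x xj] := chain_proper (ltnSn j) jr; rewrite -E xj.
Qed.

Lemma blocks_gt0 i (ir : (i < size (blocks w))%N) m n :
  m \in nth finset.set0 (blocks w) i -> n \in nth finset.set0 (blocks w) i ->
  0 < coord (mkW (blocks_neq0 ir)) m * coord (mkW (blocks_neq0 ir)) n.
Proof.
move=> mB nB; have [c c0 E] := coord_mkW (blocks_neq0 ir).
rewrite !E// mulrACA -expr2 mulr_gt0 ?exprn_even_gt0//.
have [mP wm _] := phiP w m; have [nP wn _] := phiP w n.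
rewrite (blocks_phi mB) in mP wm; rewrite (blocks_phi nB) in nP wn.
rewrite lt_neqAle eq_sym mulf_neq0//=; apply: (Bw.2) => //.
by apply/set0Pn; exists m.
Qed.

Definition pi_part : ordpart d := exist _ (blocks w) blocks_ordpart.

Definition pi_coord (i : 'I_(size (val pi_part))) :
  Wplus R (nth finset.set0 (val pi_part) i) :=
  exist _ (@mkW _ _ _ (wcoord w (K i)) (blocks_neq0 (ltn_ord i)))
    (introT (asboolP _) (@blocks_gt0 i (ltn_ord i))).

Definition pi_of : Dbar R d := existT _ pi_part pi_coord.

End Compactification.

Section Jacobi.
Context {R : realType} {d : nat} (lam : 'I_d -> R).

Section OnePoint.
Context {S : {set 'I_d}} (w : W R S).

Definition ip (p q : {poly R}) : R :=
  \sum_(n in S) coord w n * p.[lam n] * q.[lam n].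

Definition diag_coef (p : {poly R}) : R := ip p ('X * p) / ip p p.
Definition off_coef (p q : {poly R}) : R := Num.sqrt (ip q q / ip p p).

(* The pair (p_n, p_{n+1}). Rescaling w changes no quotient of values of ip, so
   diag_coef, off_coef and f depend only on the projective point. *)
Fixpoint orth_pair (n : nat) : {poly R} * {poly R} :=
  if n is n'.+1 then
    let: (p, q) := orth_pair n' in
    (q, ('X - (diag_coef q)%:P) * q - (off_coef p q ^+ 2) *: p)
  else (1, 'X - (diag_coef 1)%:P).

Definition orth (n : nat) : {poly R} := (orth_pair n).1.

(* a_{2n+1} for n >= 0 and a_{2n} for n >= 1 *)
Definition a_odd (n : nat) : R := diag_coef (orth n).
Definition a_even (n : nat) : R := off_coef (orth n.-1) (orth n).

Definition f : 'M[R]_#|S| :=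
  \matrix_(i, j) if i == j then a_odd i
                 else if j == i.+1 :> nat then a_even j
                 else if i == j.+1 :> nat then a_even i
                 else 0.

End OnePoint.

Lemma is_ordpart_card (A : {set 'I_d}) (s : seq {set 'I_d}) :
  is_ordpart A s -> (\sum_(i < size s) #|nth finset.set0 s i|)%N = #|A|.
Proof.
move=> /and3P[_ dis /eqP <-] {A}.
rewrite -(big_mkord xpredT (fun i => #|nth finset.set0 s i|)).
rewrite -(big_nth finset.set0 xpredT (fun B : {set 'I_d} => #|B|)).
elim: s dis => [|B s IH] /=; first by rewrite !big_nil cards0.
move=> /andP[/allP dB /IH ds]; rewrite !big_cons ds cardsU.
suff -> : (B :&: \bigcup_(C <- s) C)%SET = finset.set0 by rewrite cards0 subn0.
apply/setP => n; rewrite inE [RHS]inE finset.bigcup_seq.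
apply/negP => /andP[nB /finset.bigcupP[C Cs nC]].
by have := fintype.disjointFr (dB C Cs) nB; rewrite nC.
Qed.

Lemma ordpart_card (s : ordpart d) :
  (\sum_(i < size (val s)) #|nth finset.set0 (val s) i|)%N = d.
Proof. by rewrite (is_ordpart_card (valP s)) cardsT card_ord. Qed.

Definition fbar (x : Dbar R d) : 'M[R]_d :=
  castmx (ordpart_card (projT1 x), ordpart_card (projT1 x))
    (\mxdiag_(i < size (val (projT1 x))) f (val (projT2 x i))).

Definition TLam : set 'M[R]_d := (fun A =>
  [/\ A^T = A,
      forall i j : 'I_d, (i.+1 < j)%N || (j.+1 < i)%N -> A i j = 0
    & forall a : R, eigenvalue A a <-> exists n, a = lam n]).

End Jacobi.

Local Open Scope classical_set_scope.

Definition conv_hull (R : realType) (d : nat) (F : set 'rV[R]_d) : set 'rV[R]_d :=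
  smallest (@convex_set R 'rV[R]_d) F.

(* The values of a permutation are shifted back to 1, ..., d. *)
Definition perm_point (R : realType) (d : nat) (s : {perm 'I_d}) : 'rV[R]_d :=
  \row_i (s i).+1%:R.

Definition Pd (R : realType) (d : nat) : set 'rV[R]_d :=
  conv_hull (range (@perm_point R d)).

(* {g o sigma | g in Sym(R_1) x ... x Sym(R_q)}: since (s * t) x = t (s x) here,
   this is a left coset for the product of {perm 'I_d}. *)
Definition right_coset (d : nat) (Rs : seq {set 'I_d}) (sigma : {perm 'I_d}) :
  {set {perm 'I_d}} := (sigma *: \prod_(A <- Rs) Sym A)%g.

Definition face_hull (R : realType) (d : nat) (Rs : seq {set 'I_d})
    (sigma : {perm 'I_d}) : set 'rV[R]_d :=
  conv_hull (@perm_point R d @` [set` right_coset Rs sigma]).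

Definition phi_face (d : nat) (Rs : seq {set 'I_d}) (sigma : {perm 'I_d}) :
  seq {set 'I_d} := [seq (sigma @^-1: A)%SET | A : {set 'I_d} <- Rs].

Section Complex.
Context {R : realType} {d : nat} {lam : 'I_d -> R} (lam_inj : injective lam).

Definition piLam (w : set_type (BLam lam)) : Dbar R d :=
  pi_of lam_inj (set_mem (valP w)).

Definition BLam_face (s : seq {set 'I_d}) : set (set_type (BLam lam)) :=
  closure [set w | val (projT1 (piLam w)) = s].

Context (h : set_type (@Pd R d) -> set_type (BLam lam)).

Definition face_compatible : Prop :=
  forall (Rs : seq {set 'I_d}) (sigma : {perm 'I_d}),
    is_ordpart finset.setT Rs ->
    preceq [seq [set n]%SET | n <- enum 'I_d] Rs ->
    h @` [set p | face_hull Rs sigma (val p)] = BLam_face (phi_face Rs sigma).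

Definition J (p : set_type (@Pd R d)) : 'M[R]_d := fbar lam (piLam (h p)).

(* The sign of n under e is (-1) ^+ e n. *)
Definition signs : topologicalType := discrete_topology {ffun 'I_d -> bool}.

Definition diag_sign (e : signs) : 'M[R]_d :=
  diag_mx (\row_n (-1) ^+ (e : {ffun 'I_d -> bool}) n).

Definition g (x : set_type (@Pd R d) * signs) : 'M[R]_d :=
  diag_sign x.2 *m J x.1 *m diag_sign x.2.

Definition same_g : rel (set_type (@Pd R d) * signs) :=
  fun x y => g x == g y.

Lemma same_g_equiv : equiv_class_of same_g.
Proof.
split; first by move=> x; exact: eqxx.
  by move=> x y; exact: eq_sym.
by move=> y x z; rewrite /same_g => /eqP ->.
Qed.

Canonical same_g_equivRel := EquivRelPack same_g_equiv.

Definition Pbar : topologicalType :=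
  quotient_topology {eq_quot same_g_equivRel}.

Definition to_Pbar (p : set_type (@Pd R d)) (e : signs) : Pbar :=
  \pi_Pbar (p, e).

End Complex.

(* Main.v *)
From mathcomp Require Import all_boot all_order all_fingroup all_algebra.
From mathcomp Require Import generic_quotient ring lra zify.
From mathcomp Require Import all_classical all_reals all_analysis.
Require Import Defs.
Import numFieldNormedType.Exports.

(** Points of the quotient are classes of pairs with the same matrix, so the
    induced map is injective by construction; its source is compact, being a
    quotient of a polytope times a finite set, and its target is Hausdorff.  It
    remains to see that [g] is continuous and that it reaches every matrix.
    Both facts concern the map sending a point [w] of the compactified torus
    to the direct sum [fbar (pi w)] of Jacobi matrices, and both go through
    matrices [Q] whose rows are an orthonormal basis of eigenvectors, so that
    the matrix is [Q^T * diag lam * Q].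

    The point [w] and the matrix [Q] are tied by a relation, [deflated], which
    reads each projective coordinate [w^S] as the spectral measure of a unit
    vector that belongs both to the span of the first [|~: S| + 1] coordinate
    vectors and to the span of the eigenvectors indexed by [S].  Generically
    this vector is unique up to sign, and proportional to [p(A) e_1] where [p]
    is the monic polynomial with roots [lam n], [n] outside [S]: this explains
    the factors [Ccoef] in the equations of [BLam].  The relation has three
    properties.

    It is closed, since it only asks for the existence of vectors of bounded
    length that satisfy equations.  It holds between [w] and the eigenvector
    matrix of [fbar (pi w)] ([pi_deflated]); here the eigenvectors come from
    the orthonormal polynomials of each block ([eigenfun_f]), the coordinates
    [w^S] attached to the starts of the diagonal blocks are the spectral
    measures of the first vectors of the blocks ([pi_lead_compatible]), and
    the equations of [BLam] propagate this to all [S] ([lead_deflated]).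
    Finally, [w] determines the tridiagonal matrix with nonnegative
    off-diagonal entries ([deflated_unique]): column after column, the three
    term recurrence gives the next vector, and where a new block starts the
    vector that defines [w^S], for [S] the remaining eigenvalues, is forced to
    be the next coordinate vector.

    Continuity follows ([fbar_continuous]): along an ultrafilter converging to
    [w] all bounded quantities converge, the limits still satisfy the
    relation, hence give back [fbar (pi w)].  For surjectivity, signs make the
    off-diagonal entries nonnegative ([offdiag_signs]), eigenvectors exist
    because the eigenvalues are distinct, a point of [BLam] with the right
    leading coordinates can be written down from any [Q] ([weights_exist]),
    and uniqueness identifies its image. *)

Set Implicit Arguments.
Unset Strict Implicit.
Unset Printing Implicit Defensive.
Import Order.TTheory GRing.Theory Num.Theory.
Local Open Scope ring_scope.

(** * Eigenvector matrices and leading diagonal blocks *)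

Section Spectral.
Context {R : realType} {d : nat} (lam : 'I_d -> R).
Implicit Types (Q A : 'M[R]_d) (S : {set 'I_d}).

(** Rows of [Q] are indexed by eigenvalues and columns by matrix coordinates:
    for orthogonal [Q], column [a] is the [a]-th coordinate vector written in
    an eigenbasis. *)
Definition with_eigenbasis Q : 'M[R]_d :=
  Q^T *m diag_mx (\row_n lam n) *m Q.

Definition tridiagonal A : Prop :=
  forall i j : 'I_d, (i.+1 < j)%N || (j.+1 < i)%N -> A i j = 0.

Definition nonneg_offdiag A : Prop :=
  forall i j : 'I_d, j = i.+1 :> nat -> 0 <= A i j.

Definition orthogonal Q : Prop := Q *m Q^T = 1%:M.

Lemma with_eigenbasisE Q a b :
  with_eigenbasis Q a b = \sum_n lam n * Q n a * Q n b.
Proof.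
rewrite mxE; apply: eq_bigr => n _; rewrite mul_mx_diag !mxE.
by rewrite [_ * lam n]mulrC.
Qed.

Lemma with_eigenbasis_sym Q : (with_eigenbasis Q)^T = with_eigenbasis Q.
Proof. by rewrite /with_eigenbasis !trmx_mul trmxK tr_diag_mx mulmxA. Qed.

Lemma orthogonal_col Q : orthogonal Q -> forall a b,
  \sum_n Q n a * Q n b = (a == b)%:R.
Proof.
move=> /mulmx1C QQ a b; have := congr1 (fun M : 'M[R]_d => M a b) QQ.
by rewrite !mxE => <-; apply: eq_bigr => n _; rewrite !mxE.
Qed.

Lemma orthogonal_row Q : orthogonal Q -> forall m n,
  \sum_a Q m a * Q n a = (m == n)%:R.
Proof.
move=> QQ m n; have := congr1 (fun M : 'M[R]_d => M m n) QQ.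
by rewrite !mxE => <-; apply: eq_bigr => a _; rewrite !mxE.
Qed.

Lemma orthogonal_expand Q (y : 'I_d -> R) n : orthogonal Q ->
  y n = \sum_a Q n a * (\sum_m Q m a * y m).
Proof.
move=> QQ; under eq_bigr do rewrite mulr_sumr; rewrite exchange_big /=.
rewrite (bigD1 n) //= [X in _ + X]big1 ?addr0 => [|m mn].
  under eq_bigr do rewrite mulrA.
  by rewrite -mulr_suml orthogonal_row// eqxx mul1r.
under eq_bigr do rewrite mulrA.
by rewrite -mulr_suml orthogonal_row// eq_sym (negbTE mn) mul0r.
Qed.

(** Multiplication by [lam] in eigencoordinates is the matrix itself acting on
    the columns; for a tridiagonal matrix this is a three term recurrence. *)
Lemma mul_lam_col Q : orthogonal Q -> forall n a,
  lam n * Q n a = \sum_c Q n c * with_eigenbasis Q c a.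
Proof.
move=> QQ n a; rewrite (orthogonal_expand (fun n => lam n * Q n a) n QQ).
apply: eq_bigr => c _; congr (_ * _).
by rewrite with_eigenbasisE; apply: eq_bigr => m _; ring.
Qed.

Lemma with_eigenbasis_sign Q (s : 'I_d -> R) Q' :
  (forall n, s n ^+ 2 = 1) -> forall a b,
  (forall n, Q' n a = s n * Q n a) -> (forall n, Q' n b = s n * Q n b) ->
  with_eigenbasis Q' a b = with_eigenbasis Q a b.
Proof.
move=> s1 a b ea eb; rewrite !with_eigenbasisE; apply: eq_bigr => n _.
by rewrite ea eb -[RHS]mul1r -(s1 n); ring.
Qed.

Lemma eigenvalue_with_eigenbasis Q : orthogonal Q ->
  forall x : R, eigenvalue (with_eigenbasis Q) x <-> exists n, x = lam n.
Proof.
move=> QQ x; have QQ' := mulmx1C QQ.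
have QA : Q *m with_eigenbasis Q = diag_mx (\row_n lam n) *m Q.
  by rewrite /with_eigenbasis !mulmxA QQ mul1mx.
split=> [/eigenvalueP[v vA v0]|[n ->]].
  have E : (v *m Q^T) *m diag_mx (\row_n lam n) = x *: (v *m Q^T).
    have := congr1 (fun u => u *m Q^T) vA.
    by rewrite /with_eigenbasis -!scalemxAl -!mulmxA QQ mulmx1.
  have [n un] : exists n, (v *m Q^T) 0 n != 0.
    apply/existsP; apply: contraNT v0; rewrite negb_exists => /forallP u0.
    have -> : v = (v *m Q^T) *m Q by rewrite -mulmxA QQ' mulmx1.
    apply/eqP; rewrite [v *m Q^T](_ : _ = 0) ?mul0mx//.
    apply/rowP => n; rewrite [RHS]mxE; apply/eqP.
    by have := u0 n; rewrite negbK.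
  exists n; apply: (mulIf un).
  have := congr1 (fun u : 'rV[R]_d => u 0 n) E.
  by rewrite mul_mx_diag !mxE [LHS]mulrC => ->.
apply/eigenvalueP; exists (row n Q).
  by rewrite -row_mul QA mul_diag_mx; apply/rowP => a; rewrite !mxE.
apply/negP => /eqP E; have := orthogonal_row QQ n n.
rewrite eqxx big1 ?[1%:R]/1 => [/eqP|a _]; first by rewrite eq_sym oner_eq0.
by have := congr1 (fun u : 'rV[R]_d => u 0 a) E; rewrite !mxE => ->; rewrite mul0r.
Qed.

Section Split.
Variables (Q : 'M[R]_d) (k : nat).
Hypotheses (lam_inj : injective lam) (QQ : orthogonal Q).
Hypothesis block : forall c a : 'I_d, (k <= c)%N -> (a < k)%N ->
  with_eigenbasis Q c a = 0.

(** The block hypothesis says that the first [k] coordinate vectors span an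
    invariant subspace; the set below then indexes the eigenvalues of the
    leading block. *)
Definition head_support : {set 'I_d} :=
  [set n | [exists a : 'I_d, (a < k)%N && (Q n a != 0)]].

Lemma head_supportPn n : n \notin head_support ->
  forall a : 'I_d, (a < k)%N -> Q n a = 0.
Proof.
rewrite inE negb_exists => /forallP H a ak.
by have := H a; rewrite ak /= negbK => /eqP.
Qed.

Let K : 'M[R]_d := diag_mx (\row_a (a < k)%N%:R).
(* The projector on the first [k] coordinate vectors, in eigencoordinates.  It
   commutes with [diag lam], whose entries are distinct: it is diagonal, and
   its entries are 0 or 1. *)
Let P := Q *m K *m Q^T.

Let PE n m : P n m = \sum_(a : 'I_d | (a < k)%N) Q n a * Q m a.
Proof.
rewrite mxE [RHS]big_mkcond /=; apply: eq_bigr => a _; rewrite mul_mx_diag !mxE.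
by case: ifP => _; rewrite ?mulr1 ?mulr0 ?mul0r.
Qed.

Let A := with_eigenbasis Q.

Let KA : K *m A = A *m K.
Proof.
apply/matrixP => c a; rewrite mul_diag_mx mul_mx_diag [LHS]mxE [RHS]mxE.
rewrite [X in X * _]mxE [X in _ = _ * X]mxE.
have [ck|ck] := ltnP c k; have [ak|ak] := ltnP a k;
  rewrite ?mul1r ?mulr1 ?mul0r ?mulr0//.
  by rewrite /A -with_eigenbasis_sym mxE block.
by rewrite /A block.
Qed.

Let P_diag n m : n != m -> P n m = 0.
Proof.
have DP : diag_mx (\row_n lam n) *m P = P *m diag_mx (\row_n lam n).
  have QA : diag_mx (\row_n lam n) *m Q = Q *m A.
    by rewrite /A /with_eigenbasis !mulmxA QQ mul1mx.
  have AQ : Q^T *m diag_mx (\row_n lam n) = A *m Q^T.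
    by rewrite /A /with_eigenbasis -!mulmxA QQ mulmx1.
  by rewrite /P 2!mulmxA QA -(mulmxA Q A K) -KA (mulmxA Q K A)
       -(mulmxA (Q *m K) A) -AQ mulmxA.
move=> nm; have := congr1 (fun M : 'M[R]_d => M n m) DP.
rewrite mul_diag_mx mul_mx_diag !mxE mulrC => /eqP; rewrite -subr_eq0 -mulrBr.
rewrite mulf_eq0 subr_eq0 => /orP[/eqP//|/eqP/lam_inj E].
by rewrite E eqxx in nm.
Qed.

Let P_idem n : P n n = P n n ^+ 2.
Proof.
have PP : P = P *m P.
  rewrite /P !mulmxA -(mulmxA (Q *m K) Q^T Q) (mulmx1C QQ) mulmx1.
  rewrite -(mulmxA Q K K); congr (_ *m _ *m _).
  apply/matrixP => c a; rewrite mul_diag_mx !mxE.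
  by case: (ltnP c k); rewrite ?mul1r ?mul0r // mul0rn.
rewrite {1}PP mxE (bigD1 n) //= big1 ?addr0// => m mn.
by rewrite P_diag ?mul0r// eq_sym.
Qed.

Let P_head n : P n n = (n \in head_support)%:R.
Proof.
case: (boolP (n \in head_support)) => [|/head_supportPn n0].
  rewrite inE => /existsP[a /andP[ak Qna]].
  have : P n n != 0.
    rewrite gt_eqF// PE (bigD1 a)//= ltr_pwDl//.
      by rewrite -expr2 exprn_even_gt0.
    by apply: sumr_ge0 => b _; rewrite -expr2 sqr_ge0.
  move=> P0; apply: (mulIf P0); rewrite -expr2 -P_idem mulr1n mul1r //.
by rewrite PE big1// => a ak; rewrite n0// mul0r.
Qed.

Lemma head_support_tail n : n \in head_support ->
  forall c : 'I_d, (k <= c)%N -> Q n c = 0.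
Proof.
move=> nU c kc; have := orthogonal_row QQ n n; rewrite eqxx.
rewrite (bigID (fun a : 'I_d => (a < k)%N)) /= -PE P_head nU => /eqP.
rewrite -subr_eq0 addrAC subrr add0r => /eqP.
move/psumr_eq0P => H; apply/eqP; rewrite -sqrf_eq0 expr2 H //.
- by move=> i _; rewrite -expr2 sqr_ge0.
- by rewrite -leqNgt.
Qed.

Lemma card_head_support : (k <= d)%N -> #|head_support| = k.
Proof.
move=> kd; apply/eqP; rewrite -(eqr_nat R).
rewrite -sum1_card natr_sum big_mkcond /=.
under eq_bigr => n _.
  rewrite (_ : (if _ then _ else _) = P n n); first over.
  by rewrite P_head; case: ifP.
apply/eqP.
under eq_bigr do rewrite PE.
rewrite exchange_big /=.
under eq_bigr do rewrite orthogonal_col// eqxx.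
by rewrite -natr_sum -(big_ord_widen _ (fun=> 1%N) kd) sum1_card card_ord.
Qed.

End Split.
End Spectral.

(** * Projective data that determine a Jacobi matrix *)

Section Unique.
Context {R : realType} {d : nat} (lam : 'I_d -> R).
Implicit Types (Q A : 'M[R]_d) (S : {set 'I_d}).
Local Notation eigA := (with_eigenbasis lam).

(** The vector [y] is given by its eigencoordinates.  The third clause says that
    its matrix coordinates vanish beyond the first [#|~: S| + 1], and the last
    one that [wt S] is projectively the spectral measure of [y].  Neither a
    polynomial nor a cyclic vector is mentioned, so that the relation makes
    sense for reducible matrices and passes to limits. *)
Definition deflated (wt : {set 'I_d} -> 'I_d -> R) Q : Prop :=
  forall S, S != finset.set0 -> exists y : 'I_d -> R,
    [/\ \sum_n y n ^+ 2 = 1, forall n, n \notin S -> y n = 0,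
        forall l : 'I_d, (#|~: S| < l)%N -> \sum_n Q n l * y n = 0
      & forall i j, i \in S -> j \in S -> wt S i * y j ^+ 2 = wt S j * y i ^+ 2].

Variable wt : {set 'I_d} -> 'I_d -> R.
Hypothesis wt_neq0 : forall S, S != finset.set0 -> exists2 i, i \in S & wt S i != 0.
Hypothesis lam_inj : injective lam.

Lemma tridiagonal_block (A : 'M[R]_d) k : tridiagonal A ->
  (forall a c : 'I_d, a.+1 = k -> c = k :> nat -> A c a = 0) ->
  forall c a : 'I_d, (k <= c)%N -> (a < k)%N -> A c a = 0.
Proof.
move=> tA A0 c a kc ak; have [E|ne] := eqVneq (c : nat) a.+1.
  by apply: A0; lia.
by apply: tA; lia.
Qed.

(** At the start [k] of a diagonal block, the coordinates of [y] beyond [k]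
    vanish by the degree clause, and those before [k] because [y] lives on
    the eigenvalues outside the leading block: [y] is plus or minus the
    [k]-th coordinate vector. *)
Lemma deflated_column Q (k : 'I_d) : orthogonal Q ->
  (forall c a : 'I_d, (k <= c)%N -> (a < k)%N -> eigA Q c a = 0) ->
  deflated wt Q ->
  let S := (~: head_support Q k)%SET in
  forall i j, i \in S -> j \in S -> wt S i * Q j k ^+ 2 = wt S j * Q i k ^+ 2.
Proof.
move=> QQ block defl S i j iS jS.
have S0 : S != finset.set0 by apply/set0Pn; exists i.
have [y [y1 yS yl yw]] := defl S S0.
have cS : #|~: S| = k.
  by rewrite finset.setCK (card_head_support lam_inj QQ block)// ltnW.
have yE n : y n = Q n k * (\sum_m Q m k * y m).
  rewrite {1}(orthogonal_expand y n QQ) (bigD1 k)//= [X in _ + X]big1 ?addr0// => a ak.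
  have [lt|gt] := ltnP a k.
    rewrite big1 ?mulr0// => m _; have [mS|/yS->] := boolP (m \in S); last by rewrite mulr0.
    by rewrite (head_supportPn _ lt) ?mul0r//; rewrite inE in mS.
  rewrite yl ?mulr0// cS ltn_neqAle gt andbT eq_sym.
  by apply: contra_neq ak => /val_inj.
have v2 : (\sum_m Q m k * y m) ^+ 2 = 1.
  rewrite -y1; under [RHS]eq_bigr do rewrite yE exprMn.
  by rewrite -mulr_suml; under [in RHS]eq_bigr do rewrite expr2;
     rewrite orthogonal_col// eqxx mul1r.
have := yw i j iS jS; rewrite (yE i) (yE j) !exprMn v2 !mulr1.
by [].
Qed.

(** Two families of squares proportional to the same weights are equal as soon
    as their totals are. *)
Lemma proportional_squares S (x y : 'I_d -> R) :
  S != finset.set0 ->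
  \sum_n x n ^+ 2 = 1 -> \sum_n y n ^+ 2 = 1 ->
  (forall n, n \notin S -> x n = 0) -> (forall n, n \notin S -> y n = 0) ->
  (forall i j, i \in S -> j \in S -> wt S i * x j ^+ 2 = wt S j * x i ^+ 2) ->
  (forall i j, i \in S -> j \in S -> wt S i * y j ^+ 2 = wt S j * y i ^+ 2) ->
  forall n, x n ^+ 2 = y n ^+ 2.
Proof.
move=> S0 x1 y1 xS yS xw yw n; have [i iS wi] := wt_neq0 S0.
(* The common total 1 fixes the factor between weights and squares. *)
have tot (z : 'I_d -> R) : \sum_n z n ^+ 2 = 1 ->
    (forall n, n \notin S -> z n = 0) ->
    (forall i j, i \in S -> j \in S -> wt S i * z j ^+ 2 = wt S j * z i ^+ 2) ->
    wt S i = (\sum_(j in S) wt S j) * z i ^+ 2.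
  move=> z1 zS zw; rewrite mulr_suml -[LHS]mulr1 -z1 (bigID (mem S)) /=.
  rewrite [X in _ + X]big1 ?addr0 => [|j /zS ->]; last by rewrite expr0n.
  by rewrite mulr_sumr; apply: eq_bigr => j jS; rewrite zw.
have T0 : \sum_(j in S) wt S j != 0.
  by apply: contra_neq wi => T0; rewrite (tot x)// T0 mul0r.
have Ei : x i ^+ 2 = y i ^+ 2.
  by apply: (mulfI T0); rewrite -(tot x) // -(tot y).
have [nS|nS] := boolP (n \in S); last by rewrite xS// yS.
by apply: (mulfI wi); rewrite xw// yw// Ei.
Qed.

Section TwoBases.
Variables Q Q' : 'M[R]_d.
Hypotheses (QQ : orthogonal Q) (QQ' : orthogonal Q').
Hypotheses (tA : tridiagonal (eigA Q)) (tA' : tridiagonal (eigA Q')).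
Hypotheses (nA : nonneg_offdiag (eigA Q)) (nA' : nonneg_offdiag (eigA Q')).
Hypotheses (defl : deflated wt Q) (defl' : deflated wt Q').

(** Eigenvectors are only defined up to sign, hence the signs [s]. *)
Definition agree_upto k := exists2 s : 'I_d -> R, forall n, s n ^+ 2 = 1 &
  forall a : 'I_d, (a < k)%N -> forall n, Q' n a = s n * Q n a.

(** Where a block starts, the next column is known up to signs only, through
    its squares.  These signs may be absorbed in [s]: the previous columns
    vanish on the eigenvectors concerned. *)
Lemma agree_split (k : 'I_d) :
  (forall c a : 'I_d, (k <= c)%N -> (a < k)%N -> eigA Q c a = 0) ->
  (forall c a : 'I_d, (k <= c)%N -> (a < k)%N -> eigA Q' c a = 0) ->
  agree_upto k -> agree_upto k.+1.
Proof.
move=> bl bl' [s s1 sQ]; set U := head_support Q k.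
have s0 n : s n != 0 by rewrite -sqrf_eq0 s1 oner_eq0.
have UU : head_support Q' k = U.
  apply/setP => n; rewrite !inE; apply: eq_existsb => a.
  by case: (ltnP a k) => //= ak; rewrite sQ// mulf_eq0 (negbTE (s0 n)).
have cU : #|U| = k by apply: (card_head_support lam_inj QQ bl); rewrite ltnW.
have S0 : (~: U)%SET != finset.set0.
  by rewrite -card_gt0 cardsCs finset.setCK cU card_ord subn_gt0.
have tU n : n \in U -> Q n k = 0.
  by move=> nU; apply: (head_support_tail lam_inj QQ bl nU).
have tU' n : n \in U -> Q' n k = 0.
  by rewrite -UU => nU; apply: (head_support_tail lam_inj QQ' bl' nU).
have col1 (P : 'M[R]_d) : orthogonal P -> \sum_n P n k ^+ 2 = 1.
  by move=> PP; under eq_bigr do rewrite expr2; rewrite orthogonal_col// eqxx.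
have sq n : Q n k ^+ 2 = Q' n k ^+ 2.
  apply: (@proportional_squares (~: U)%SET (fun n => Q n k) (fun n => Q' n k)) => //.
  - exact: col1.
  - exact: col1.
  - by move=> m; rewrite inE negbK; exact: tU.
  - by move=> m; rewrite inE negbK; exact: tU'.
  - by apply: deflated_column.
  - by rewrite -UU; apply: deflated_column.
exists (fun n => if n \in U then s n else if Q n k == 0 then 1 else Q' n k / Q n k).
  move=> n; case: ifP => // _; case: eqP => [|/eqP Q0]; first by rewrite expr1n.
  by rewrite expr_div_n -sq divff// expf_neq0.
move=> a; rewrite ltnS leq_eqVlt => /orP[/eqP/val_inj->|ak] n.
  case: ifP => [nU|_]; first by rewrite tU'// tU// mulr0.
  case: eqP => [Q0|/eqP Q0]; last by rewrite divfK.
  by rewrite Q0 mulr0; apply/eqP; rewrite -sqrf_eq0 -sq Q0 expr0n.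
case: ifPn => [nU|nU]; first exact: sQ.
by rewrite sQ// (head_supportPn nU ak) !mulr0.
Qed.

(** The recurrence gives the next column up to the off-diagonal entry, which
    is the norm of the residual [r] and therefore the same for both matrices;
    if it is zero, a new block starts. *)
Lemma agree_next (a k : 'I_d) : k = a.+1 :> nat -> agree_upto k -> agree_upto k.+1.
Proof.
move=> ka [s s1 sQ].
have ak : (a < k)%N by rewrite ka.
pose r (P : 'M[R]_d) n := lam n * P n a - \sum_(c : 'I_d | (c < k)%N) P n c * eigA P c a.
have rE P n : orthogonal P -> tridiagonal (eigA P) -> r P n = P n k * eigA P k a.
  move=> PP tP; rewrite /r (mul_lam_col lam PP) (bigID (fun c : 'I_d => (c < k)%N)) /=.
  rewrite addrAC subrr add0r (bigD1 k) ?ltnn//= [X in _ + X]big1 ?addr0// => c /andP[kc ck].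
  rewrite tP ?mulr0//; apply/orP; right; move: ck; rewrite -val_eqE /= => ck.
  by rewrite -leqNgt in kc; lia.
have r1 P : orthogonal P -> tridiagonal (eigA P) -> \sum_n r P n ^+ 2 = eigA P k a ^+ 2.
  move=> PP tP; under eq_bigr do rewrite rE// exprMn.
  rewrite -mulr_suml; under eq_bigr do rewrite expr2.
  by rewrite orthogonal_col// eqxx mul1r.
have rs n : r Q' n = s n * r Q n.
  rewrite /r sQ// mulrBr mulr_sumr; congr (_ - _); first ring.
  apply: eq_bigr => c ck; rewrite sQ//.
  rewrite (with_eigenbasis_sign lam s1 (sQ c ck) (sQ a ak)); ring.
have nn P : nonneg_offdiag (eigA P) -> 0 <= eigA P k a.
  by move=> nP; rewrite -with_eigenbasis_sym mxE nP.
have Eb : eigA Q' k a = eigA Q k a.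
  apply/eqP; rewrite -(eqrXn2 (n:=2)) ?nn// -!r1//; apply/eqP/eq_bigr => n _.
  by rewrite rs exprMn s1 mul1r.
have [b0|b0] := eqVneq (eigA Q k a) 0; last first.
  exists s => // c; rewrite ltnS leq_eqVlt => /orP[/eqP/val_inj->|ck] n; last exact: sQ.
  apply: (mulIf b0); rewrite -{1}Eb -rE// -mulrA -rE//.
apply: agree_split; last by exists s.
- apply: tridiagonal_block => // a' c' E1 E2.
  have -> : a' = a by apply: val_inj => /=; lia.
  by have -> : c' = k by [apply: val_inj].
- apply: tridiagonal_block => // a' c' E1 E2.
  have -> : a' = a by apply: val_inj => /=; lia.
  by have -> : c' = k by [apply: val_inj]; rewrite Eb.
Qed.

Lemma deflated_unique : eigA Q' = eigA Q.
Proof.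
have : forall k, (k <= d)%N -> agree_upto k.
  elim=> [_|k IH kd]; first by exists (fun=> 1) => // n; rewrite expr1n.
  have := IH (ltnW kd); rewrite -[k]/(nat_of_ord (Ordinal kd)).
  case: k {IH} kd => [|k] kd.
    by apply: agree_split => c a _; rewrite ltn0.
  by apply: (@agree_next (Ordinal (ltnW kd))).
move=> /(_ d (leqnn d)) [s s1 sQ]; apply/matrixP => a b.
by apply: (with_eigenbasis_sign lam s1); apply: sQ.
Qed.

End TwoBases.
End Unique.

(** * Weights attached to an eigenvector matrix *)

Section Lead.
Context {R : realType} {d : nat} (lam : 'I_d -> R).
Hypothesis lam_inj : injective lam.
Implicit Types (Q A : 'M[R]_d) (S : {set 'I_d}) (wt : {set 'I_d} -> 'I_d -> R).
Local Notation eigA := (with_eigenbasis lam).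

(** The hypotheses on [k] and [S] say that a diagonal block starts at [k] and
    that [S] indexes the eigenvalues of the part from [k] on.  The weights on
    [S] are then the spectral measure of the [k]-th coordinate vector. *)
Definition lead_compatible wt Q : Prop :=
  forall (k : 'I_d) S,
    (forall n (a : 'I_d), n \in S -> (a < k)%N -> Q n a = 0) ->
    (forall n (a : 'I_d), n \notin S -> (k <= a)%N -> Q n a = 0) ->
  forall i j, i \in S -> j \in S -> wt S i * Q j k ^+ 2 = wt S j * Q i k ^+ 2.

(** The first coordinate vector whose spectral measure meets [S]. *)
Definition is_lead Q S (a : 'I_d) : Prop :=
  (exists2 n, n \in S & Q n a != 0) /\
  forall n (b : 'I_d), n \in S -> (b < a)%N -> Q n b = 0.

Lemma orthogonal_row_neq0 Q n : orthogonal Q -> exists a, Q n a != 0.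
Proof.
move=> QQ; apply/existsP; apply: contraT; rewrite negb_exists => /forallP H.
have := orthogonal_row QQ n n; rewrite eqxx big1 => [/eqP|a _].
  by rewrite eq_sym oner_eq0.
by have := H a; rewrite negbK => /eqP->; rewrite mul0r.
Qed.

Lemma orthogonal_col_neq0 Q a : orthogonal Q -> exists n, Q n a != 0.
Proof.
move=> QQ; apply/existsP; apply: contraT; rewrite negb_exists => /forallP H.
have := orthogonal_col QQ a a; rewrite eqxx big1 => [/eqP|n _].
  by rewrite eq_sym oner_eq0.
by have := H n; rewrite negbK => /eqP->; rewrite mul0r.
Qed.

Lemma lead_exists Q S : orthogonal Q -> S != finset.set0 -> exists a, is_lead Q S a.
Proof.
move=> QQ /set0Pn[n nS]; have [a0 Qa0] := orthogonal_row_neq0 n QQ.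
pose p (a : 'I_d) := [exists n in S, Q n a != 0].
have pa0 : p a0 by apply/exists_inP; exists n.
case: (arg_minnP (fun a : 'I_d => a : nat) pa0) => a /exists_inP[m mS Qm] amin.
exists a; split; first by exists m.
move=> m' b m'S ba; apply/eqP; apply: contraTT ba => Qb; rewrite -leqNgt.
by apply: amin; apply/exists_inP; exists m'.
Qed.

(** For a tridiagonal matrix [A], each factor [A - lam m] raises by at most one
    the last nonzero matrix coordinate of a vector. *)
Lemma deflation_degree Q (a : 'I_d) (s : seq 'I_d) : orthogonal Q ->
  tridiagonal (eigA Q) -> forall l : 'I_d, (a + size s < l)%N ->
  \sum_n Q n l * (Q n a * \prod_(m <- s) (lam n - lam m)) = 0.
Proof.
move=> QQ tA; elim: s => [|m0 s IH] l /=.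
  rewrite addn0 => al; under eq_bigr do rewrite big_nil mulr1.
  rewrite orthogonal_col//; case: eqP => // E; by rewrite E ltnn in al.
rewrite addnS => al.
pose y n := Q n a * \prod_(m <- s) (lam n - lam m).
transitivity (\sum_n (\sum_c Q n c * eigA Q c l) * y n - lam m0 * \sum_n Q n l * y n).
  rewrite mulr_sumr -sumrB; apply: eq_bigr => n _.
  by rewrite -mul_lam_col// big_cons /y; ring.
rewrite [X in _ - _ * X]IH ?mulr0 ?subr0; last by lia.
under eq_bigr do rewrite mulr_suml.
rewrite exchange_big big1 //= => c _.
have [lt|ge] := ltnP (a + size s) c.
  under eq_bigr do rewrite mulrAC.
  by rewrite -mulr_suml [X in X * _]IH ?mul0r.
by rewrite big1// => n _; rewrite tA ?mulr0 ?mul0r//; lia.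
Qed.

(** If the entry linking [a] to the previous coordinate were nonzero, the
    recurrence would express column [a] through columns that vanish on [S]. *)
Lemma is_lead_block Q S a : orthogonal Q -> tridiagonal (eigA Q) ->
  is_lead Q S a ->
  forall c b : 'I_d, (a <= c)%N -> (b < a)%N -> eigA Q c b = 0.
Proof.
move=> QQ tA [[n nS Qn] below]; apply: tridiagonal_block => // b c ba ca.
have -> : c = a by apply: val_inj.
have bb : (b < a)%N by rewrite -ba.
have := mul_lam_col lam QQ n b; rewrite below// mulr0 (bigD1 a)//= big1 ?addr0.
  by move/esym/eqP; rewrite mulf_eq0 (negbTE Qn) => /eqP.
move=> e ea; have [lt|gt] := ltnP e a; first by rewrite below// mul0r.
by rewrite tA ?mulr0//; move: ea; rewrite -val_eqE /= => ea; lia.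
Qed.

Definition weight_relations wt : Prop :=
  forall S T : {set 'I_d}, S != finset.set0 -> S \subset T -> forall i j, i \in S -> j \in S ->
     Ccoef lam i (T :\: S)%SET * wt S j * wt T i =
     Ccoef lam j (T :\: S)%SET * wt S i * wt T j.

(** Let [a] be the lead of [S] and [K] the set of eigenvalues of the part of the
    matrix from [a] on.  The weights on [K] are the squares of column [a].
    Passing from [K] to [S] multiplies the weights by the squares of
    [p n = \prod_(m in K :\: S) (lam n - lam m)], which is what happens to
    the spectral measure when [p(A)] is applied to the [a]-th coordinate
    vector; the result is the required vector up to normalization. *)
Lemma lead_deflated wt Q :
  (forall S, S != finset.set0 -> exists2 i, i \in S & wt S i != 0) ->
  weight_relations wt -> orthogonal Q -> tridiagonal (eigA Q) ->
  lead_compatible wt Q -> deflated wt Q.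
Proof.
move=> wt0 rel QQ tA cmp S S0.
have [a la] := lead_exists QQ S0; have [[t tS Qt] below] := la.
have block := is_lead_block QQ tA la.
set U := head_support Q a; pose K := (~: U)%SET.
have cU : #|U| = a by apply: (card_head_support lam_inj QQ block); rewrite ltnW.
have SK : S \subset K.
  apply/fintype.subsetP => n nS; rewrite !inE negb_exists; apply/forallP => b.
  by case: (ltnP b a) => //= ba; rewrite below// eqxx.
pose p n := \prod_(m in K :\: S) (lam n - lam m).
pose y n := Q n a * p n.
have p0 n : n \in S -> p n != 0.
  move=> nS; apply/prodf_neq0 => m; rewrite inE => /andP[mS _].
  by rewrite subr_eq0; apply: contraNneq mS => /lam_inj <-.
have yS n : n \notin S -> y n = 0.
  move=> nS; rewrite /y; have [nU|nU] := boolP (n \in U).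
    by rewrite (head_support_tail lam_inj QQ block nU)// mul0r.
  have nKS : n \in K :\: S by rewrite finset.in_setD nS finset.in_setC.
  by rewrite /p (bigD1 n)//= subrr mul0r mulr0.
pose N := \sum_n y n ^+ 2.
have N0 : 0 < N.
  rewrite /N (bigD1 t)//= ltr_pwDl ?sumr_ge0//.
    by rewrite exprn_even_gt0//= mulf_neq0// p0.
  by move=> *; rewrite sqr_ge0.
have deg (l : 'I_d) : (#|~: S| < l)%N -> \sum_n Q n l * y n = 0.
  move=> Sl; rewrite /y /p; under eq_bigr do rewrite -big_enum.
  apply: deflation_degree => //; rewrite -cardE.
  suff : (a + #|K :\: S| = #|~: S|)%N by move=> E; rewrite E.
  rewrite cardsD (finset.setIidPr SK) -cU.
  have := cardsC U; have := subset_leq_card SK; have := cardsC S.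
  by rewrite card_ord /K; lia.
have [kap kap0 wK] : exists2 kap, kap != 0 & forall n, n \in K -> wt K n = kap * Q n a ^+ 2.
  have tK := fintype.subsetP SK _ tS.
  have K0 : K != finset.set0 by apply/set0Pn; exists t.
  have lK n : n \in K -> wt K n = wt K t / Q t a ^+ 2 * Q n a ^+ 2.
    move=> nK; apply: (@mulIf _ (Q t a ^+ 2)); first by rewrite expf_neq0.
    rewrite -(cmp a K) //.
    - by field.
    - move=> m b; rewrite inE => mU; exact: head_supportPn.
    - move=> m b; rewrite inE negbK => mU; exact: (head_support_tail lam_inj QQ block mU).
  exists (wt K t / Q t a ^+ 2) => //.
  have [i iK wi] := wt0 _ K0.
  by apply: contra_neq wi => E; rewrite lK// E mul0r.
have Cp n : Ccoef lam n (K :\: S) = p n ^+ 2.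
  rewrite /Ccoef /p -prodrXl; apply: eq_bigr => m _.
  by rewrite -sqrrN opprB.
have yw i j : i \in S -> j \in S -> wt S i * y j ^+ 2 = wt S j * y i ^+ 2.
  move=> iS jS; have := rel S K S0 SK i j iS jS.
  rewrite !Cp !wK ?(fintype.subsetP SK)// => E.
  by apply: (mulfI kap0); rewrite /y; lra.
pose c := (Num.sqrt N)^-1.
have c2 : c ^+ 2 = N^-1 by rewrite exprVn sqr_sqrtr// ltW.
exists (fun n => c * y n); split.
- by under eq_bigr do rewrite (exprMn _ c (y _)); rewrite -mulr_sumr -/N c2 mulVf// gt_eqF.
- by move=> n /yS ->; rewrite mulr0.
- move=> l /deg E; under eq_bigr do rewrite mulrCA.
  by rewrite -mulr_sumr E mulr0.
- by move=> i j iS jS; rewrite !(exprMn _ c (y _)) mulrCA yw// mulrCA.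
Qed.

(** The formula for the weights on [S] is forced: with [a] the lead of [S], they
    are obtained from the squares of column [a] by deflating the eigenvalues
    outside [S] that are not already used before [a].  In the equations of
    [BLam] for two sets, either the leads agree and the [Ccoef] factors
    multiply, or the weights of the larger set vanish on the smaller one. *)
Lemma weights_exist Q : orthogonal Q ->
  exists w : Wprod R d, BLam lam w /\ lead_compatible (wcoord w) Q.
Proof.
move=> QQ.
pose raw S (a n : 'I_d) := Ccoef lam n (~: (head_support Q a :|: S))%SET * Q n a ^+ 2.
have one (S : {S : {set 'I_d} | S != finset.set0}) :
    exists u : W R (val S), exists a : 'I_d, is_lead Q (val S) a /\
      exists2 c, c != 0 & forall n, n \in val S -> coord u n = c * raw (val S) a n.
  have [a la] := lead_exists QQ (valP S).
  have nz : exists2 n, n \in val S & raw (val S) a n != 0.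
    have [[n nS Qn] _] := la; exists n => //.
    rewrite mulf_neq0 ?expf_neq0// Ccoef_neq0//.
    by rewrite !inE negbK nS orbT.
  by exists (mkW nz), a; split=> //; exact: coord_mkW.
pose w : Wprod R d := fun S : {S : {set 'I_d} | S != finset.set0} => projT1 (cid (one S)).
have wE S : S != finset.set0 -> exists a : 'I_d, is_lead Q S a /\
   exists2 c, c != 0 & forall n, n \in S -> wcoord w S n = c * raw S a n.
  move=> S0; have := projT2 (cid (one (exist _ S S0))); rewrite -/(w (exist _ S S0)).
  by move=> [a [la [c c0 E]]]; exists a; split=> //; exists c => // n nS;
     rewrite /wcoord insubT /= E.
exists w; split; first split.
- move=> S T S0 ST i j iS jS.
  have T0 : T != finset.set0.
    by apply/set0Pn; exists i; exact: (fintype.subsetP ST).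
  have [a [[[n nS Qn] below] [c c0 E]]] := wE S S0.
  have [b [[_ below'] [e e0 F]]] := wE T T0.
  have inT := fintype.subsetP ST.
  have [ab|ba] := ltnP a b.
    by rewrite below' ?eqxx ?inT in Qn.
  rewrite !F ?inT//; have [ba'|ab] := ltnP b a.
    by rewrite /raw !below// expr0n !mulr0.
  have {ab}ab : a = b by apply: val_inj; apply/eqP; rewrite eqn_leq ab.
  subst b; rewrite !E// /raw.
  have CE x : x \in S -> Ccoef lam x (~: (head_support Q a :|: S)) =
      Ccoef lam x (T :\: S) * Ccoef lam x (~: (head_support Q a :|: T)).
    move=> xS; rewrite /Ccoef (big_setID T) /=; congr (_ * _); apply: eq_bigl => m.
      rewrite !(finset.in_setC, finset.in_setU, finset.in_setD, finset.in_setI).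
      have [mT|mT] := boolP (m \in T); rewrite ?andbT ?andbF//.
      suff /negbTE -> : m \notin head_support Q a by [].
      rewrite inE negb_exists; apply/forallP => x'.
      by case: (ltnP x' a) => //= lt; rewrite below'// eqxx.
    rewrite !(finset.in_setC, finset.in_setU, finset.in_setD).
    have [mT|mT] := boolP (m \in T); rewrite ?orbT ?andbF//= ?andbT.
    have /negbTE -> : m \notin S by apply: contra mT; exact: inT.
    by rewrite !orbF ?andbT.
  rewrite !CE//; ring.
- move=> S S0 i j iS jS; have [a [_ [c c0 E]]] := wE S S0.
  rewrite !E// mulrACA -expr2 mulr_ge0 ?sqr_ge0// /raw.
  have C0 n T : 0 <= Ccoef lam n T by apply: prodr_ge0 => *; exact: sqr_ge0.
  by apply: mulr_ge0; apply: mulr_ge0 => //; exact: sqr_ge0.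
- move=> k S lo hi i j iS jS.
  have S0 : S != finset.set0 by apply/set0Pn; exists i.
  have [a [[[n nS Qn] below] [c c0 E]]] := wE S S0.
  have ak : a = k.
    have [ak|ka|/val_inj//] := ltngtP a k.
      by rewrite lo ?eqxx in Qn.
    have [m Qm] := orthogonal_col_neq0 k QQ.
    have [mS|mS] := boolP (m \in S); first by rewrite below ?eqxx in Qm.
    by rewrite hi ?eqxx in Qm.
  subst a; rewrite !E// /raw.
  rewrite (_ : (~: _)%SET = finset.set0) /Ccoef ?big_set0; first ring.
  apply/setP => m; rewrite !inE; apply/negbTE; rewrite negbK.
  have [mS|mS] := boolP (m \in S); rewrite ?orbT// orbF.
  have [b Qb] := orthogonal_row_neq0 m QQ; apply/existsP; exists b.
  rewrite Qb andbT ltnNge; apply/negP => kb.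
  by rewrite hi ?eqxx in Qb.
Qed.

End Lead.

(** * Orthonormal polynomials as eigenvectors *)

Section OrthogonalPolynomials.
Context {R : realType} {d : nat} (lam : 'I_d -> R) (lam_inj : injective lam).
Context {S : {set 'I_d}} (w : W R S).
Hypothesis w_pos : forall m n, m \in S -> n \in S -> 0 < coord w m * coord w n.
Local Notation "<< p , q >>" := (ip lam w p q).
Local Notation P := (orth lam w).

Lemma ipC (p q : {poly R}) : <<p, q>> = <<q, p>>.
Proof. by apply: eq_bigr => n _; rewrite mulrAC. Qed.

Lemma ipDl (p q r : {poly R}) : <<p + q, r>> = <<p, r>> + <<q, r>>.
Proof. by rewrite -big_split; apply: eq_bigr => n _ /=; rewrite hornerD; ring. Qed.

Lemma ipZl a (p r : {poly R}) : <<a *: p, r>> = a * <<p, r>>.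
Proof. by rewrite mulr_sumr; apply: eq_bigr => n _ /=; rewrite hornerZ; ring. Qed.

Lemma ip_mulX (p q : {poly R}) : <<'X * p, q>> = <<p, 'X * q>>.
Proof. by apply: eq_bigr => n _ /=; rewrite !hornerM hornerX; ring. Qed.

(** The coordinates of a positive projective point have a common sign, which may
    be negative; multiplying by the mass makes them positive. *)
Definition mass : R := \sum_(n in S) coord w n.

Lemma mass_coord_gt0 n : n \in S -> 0 < mass * coord w n.
Proof.
move=> nS; rewrite mulr_suml (bigD1 n)//= ltr_pwDl ?w_pos//.
by apply: sumr_ge0 => m /andP[mS _]; rewrite ltW ?w_pos.
Qed.

(** A polynomial of degree less than the number of nodes cannot vanish at all
    of them. *)
Lemma mass_ip_gt0 (p : {poly R}) : p != 0 -> (size p <= #|S|)%N -> 0 < mass * <<p, p>>.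
Proof.
move=> p0 pS.
have [n nS pn] : exists2 n, n \in S & p.[lam n] != 0.
  apply/exists_inP; apply: contraT; rewrite negb_exists_in => /forall_inP H.
  suff : (size [seq lam n | n <- enum S] < size p)%N.
    by rewrite size_map -cardE ltnNge pS.
  apply: max_poly_roots => //; last by rewrite map_inj_uniq ?enum_uniq.
  apply/allP => _ /mapP[n + ->]; rewrite mem_enum => nS.
  by have := H n nS; rewrite negbK.
rewrite mulr_sumr (bigD1 n)//= ltr_pwDl//.
  rewrite -mulrA mulrA mulr_gt0 ?mass_coord_gt0//.
  by rewrite -expr2 exprn_even_gt0.
apply: sumr_ge0 => m /andP[mS _]; rewrite -mulrA mulrA mulr_ge0//.
  by rewrite ltW ?mass_coord_gt0.
by rewrite -expr2 sqr_ge0.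
Qed.

Lemma orth_pair_snd n : (orth_pair lam w n).2 = P n.+1.
Proof. by rewrite /orth /=; case: orth_pair. Qed.

Lemma orthSS n : P n.+2 = ('X - (a_odd lam w n.+1)%:P) * P n.+1
                          - (a_even lam w n.+1 ^+ 2) *: P n.
Proof.
rewrite -[LHS]orth_pair_snd /= /a_odd /a_even /= -orth_pair_snd /orth.
by case: orth_pair.
Qed.

Lemma orth1 : P 1 = 'X - (a_odd lam w 0)%:P.
Proof. by []. Qed.

Lemma orth_monic_size n : P n \is monic /\ size (P n) = n.+1.
Proof.
suff : (P n \is monic /\ size (P n) = n.+1) /\
       (P n.+1 \is monic /\ size (P n.+1) = n.+2) by case.
elim: n => [|n [[m0 s0] [m1 s1]]].
  by rewrite orth1 monicXsubC size_XsubC monic1 size_poly1.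
split=> //; rewrite orthSS.
have sl : size (('X - (a_odd lam w n.+1)%:P) * P n.+1) = n.+3.
  by rewrite size_monicM ?monicXsubC ?monic_neq0// size_XsubC s1.
have lt : (size (- (a_even lam w n.+1 ^+ 2 *: P n))%R <
           size (('X - (a_odd lam w n.+1)%:P)%R * P n.+1)%R)%N.
  by rewrite size_polyN sl (leq_ltn_trans (size_scale_leq _ _))// s0.
split; last by rewrite size_polyDl.
by rewrite monicE lead_coefDl// -monicE monicMl ?monicXsubC.
Qed.

Lemma orth_neq0 n : P n != 0.
Proof. by rewrite monic_neq0//; case: (orth_monic_size n). Qed.

Lemma mulX_orth0 : 'X * P 0 = P 1 + a_odd lam w 0 *: P 0.
Proof. by rewrite orth1 mulr1 -mul_polyC mulr1 subrK. Qed.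

Lemma mulX_orthS n :
  'X * P n.+1 = P n.+2 + a_odd lam w n.+1 *: P n.+1 + a_even lam w n.+1 ^+ 2 *: P n.
Proof. by rewrite orthSS mulrBl mul_polyC addrAC subrK subrK. Qed.

Lemma mass_norm_gt0 n : (n < #|S|)%N -> 0 < mass * <<P n, P n>>.
Proof. by move=> nS; rewrite mass_ip_gt0 ?orth_neq0//; case: (orth_monic_size n) => _ ->. Qed.

Lemma norm_neq0 n : (n < #|S|)%N -> <<P n, P n>> != 0.
Proof.
by move/mass_norm_gt0 => H; apply: contraTneq H => ->; rewrite mulr0 ltxx.
Qed.

Lemma a_even_sqr n : (n.+1 < #|S|)%N ->
  a_even lam w n.+1 ^+ 2 = <<P n.+1, P n.+1>> / <<P n, P n>>.
Proof.
move=> nS; rewrite /a_even /off_coef sqr_sqrtr//=.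
have := mass_norm_gt0 nS; have := mass_norm_gt0 (ltnW nS) => H0 H1.
have := divr_gt0 H1 H0; rewrite -mulf_div divff ?mul1r; first exact: ltW.
by apply: contraTneq H0 => ->; rewrite mul0r ltxx.
Qed.

(** In the product of [P n.+2] with [P j], multiplication by ['X] can be moved
    to [P j], which leaves only [j = n] and [j = n.+1] to consider; the two
    coefficients of the recurrence are chosen to cancel these products. *)
Lemma orth_orthogonal i j : (i < #|S|)%N -> (j < i)%N -> <<P i, P j>> = 0.
Proof.
suff H n : (n < #|S|)%N -> forall i j, (i <= n)%N -> (j < i)%N -> <<P i, P j>> = 0.
  by move=> iS; exact: (H i).
elim: n {i j} => [|n IH] nS i j; first by case: i.
have {}IH := IH (ltnW nS); rewrite leq_eqVlt => /orP[/eqP->{i}|]; last exact: IH.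
have IHs i k : (i <= n)%N -> (k <= n)%N -> i != k -> <<P i, P k>> = 0.
  move=> li lk; case: ltngtP => // ik _; last exact: IH.
  by rewrite ipC IH.
case: n => [|n] in nS IH IHs *.
  case: j => // _; have := ip_mulX (P 0) (P 0).
  rewrite {1}mulX_orth0 ipDl ipZl /a_odd /diag_coef divfK ?norm_neq0//; last by lia.
  by move/eqP; rewrite -subr_eq0 addrK => /eqP.
rewrite ltnS leq_eqVlt => /orP[/eqP->{j}|].
  have := ip_mulX (P n.+1) (P n.+1).
  rewrite {1}mulX_orthS !ipDl !ipZl (IHs n n.+1)//; last by lia.
  rewrite /a_odd /diag_coef divfK ?norm_neq0//; last by lia.
  by move/eqP; rewrite mulr0 addr0 -subr_eq0 addrK => /eqP.
rewrite ltnS leq_eqVlt => /orP[/eqP->{j}|jn].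
  have := ip_mulX (P n.+1) (P n); rewrite {1}mulX_orthS !ipDl !ipZl.
  rewrite (IHs n.+1 n)//; last by lia.
  rewrite mulr0 addr0 a_even_sqr; last by lia.
  rewrite divfK ?norm_neq0//; last by lia.
  suff -> : <<P n.+1, 'X * P n>> = <<P n.+1, P n.+1>>.
    by move/eqP; rewrite -subr_eq0 addrK => /eqP.
  rewrite ipC; case: n => [|n] in nS IH IHs *.
    by rewrite mulX_orth0 ipDl ipZl (IHs 0)// mulr0 addr0.
  rewrite mulX_orthS !ipDl !ipZl (IHs n.+1)//; try lia.
  by rewrite (IHs n n.+2)//; try lia; rewrite !mulr0 !addr0.
have := ip_mulX (P n.+1) (P j); rewrite {1}mulX_orthS !ipDl !ipZl.
rewrite (IHs n.+1 j)//; try lia.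
rewrite (IHs n j)//; try lia.
suff -> : <<P n.+1, 'X * P j>> = 0 by rewrite !mulr0 !addr0.
rewrite ipC; case: j => [|j] in jn *.
  by rewrite mulX_orth0 ipDl ipZl !IHs// ?mulr0 ?addr0//; lia.
by rewrite mulX_orthS !ipDl !ipZl !IHs ?mulr0 ?addr0//; lia.
Qed.

(** Values at the node [n] of the [l]-th orthonormal polynomial times the square
    root of the weight.  As functions of [l], these are the coordinates of a
    normalized eigenvector of the Jacobi matrix. *)
Definition eigenfun l n : R :=
  (P l).[lam n] * Num.sqrt (mass * coord w n) / Num.sqrt (mass * <<P l, P l>>).

Lemma eigenfun_sum (h : 'I_d -> R) i j :
  \sum_(n in S) h n * eigenfun i n * eigenfun j n =
  mass * (\sum_(n in S) h n * (coord w n * (P i).[lam n] * (P j).[lam n])) /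
  (Num.sqrt (mass * <<P i, P i>>) * Num.sqrt (mass * <<P j, P j>>)).
Proof.
rewrite mulr_sumr mulr_suml; apply: eq_bigr => n nS; rewrite /eigenfun.
have := sqr_sqrtr (ltW (mass_coord_gt0 nS)).
set s := Num.sqrt (mass * coord w n) => E.
rewrite invfM.
transitivity (s ^+ 2 * (h n * (P i).[lam n] * (P j).[lam n] /
  Num.sqrt (mass * <<P i, P i>>) / Num.sqrt (mass * <<P j, P j>>))); first ring.
by rewrite E; ring.
Qed.

Lemma eigenfun_orthonormal i j : (i < #|S|)%N -> (j < #|S|)%N ->
  \sum_(n in S) eigenfun i n * eigenfun j n = (i == j)%:R.
Proof.
move=> iS jS; under eq_bigr do rewrite -[X in X * _]mul1r.
rewrite (eigenfun_sum (fun=> 1)); under eq_bigr do rewrite mul1r.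
rewrite -/(ip lam w _ _); case: (ltngtP i j) => [ij|ji|->].
- by rewrite ipC orth_orthogonal// mulr0 mul0r.
- by rewrite orth_orthogonal// mulr0 mul0r.
- by rewrite -expr2 sqr_sqrtr ?ltW ?mass_norm_gt0// divff// gt_eqF ?mass_norm_gt0.
Qed.

(** The Jacobi matrix represents multiplication by the variable in the basis of
    orthonormal polynomials. *)
Lemma eigenfun_f (i j : 'I_#|S|) :
  f lam w i j = \sum_(n in S) lam n * eigenfun i n * eigenfun j n.
Proof.
rewrite eigenfun_sum.
have -> : \sum_(n in S) lam n * (coord w n * (P i).[lam n] * (P j).[lam n]) =
    <<'X * P i, P j>>.
  by apply: eq_bigr => n _; rewrite hornerM hornerX; ring.
have low k b : (b < #|S|)%N -> (k < b)%N -> <<P k, P b>> = 0.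
  by move=> bS kb; rewrite ipC orth_orthogonal.
have off a b : (b < #|S|)%N -> (a.+1 < b)%N -> <<'X * P a, P b>> = 0.
  move=> bS ab; case: a => [|a] in ab *.
    by rewrite mulX_orth0 ipDl ipZl !low ?mulr0 ?addr0//; lia.
  by rewrite mulX_orthS !ipDl !ipZl !low ?mulr0 ?addr0//; lia.
have next a : (a.+1 < #|S|)%N -> <<'X * P a, P a.+1>> = <<P a.+1, P a.+1>>.
  move=> aS; case: a => [|a] in aS *.
    by rewrite mulX_orth0 ipDl ipZl (low 0%N)// mulr0 addr0.
  by rewrite mulX_orthS !ipDl !ipZl (low a.+1)// (low a)// !mulr0 !addr0.
have nextE a : (a.+1 < #|S|)%N -> mass * <<P a.+1, P a.+1>> /
    (Num.sqrt (mass * <<P a, P a>>) * Num.sqrt (mass * <<P a.+1, P a.+1>>)) =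
    a_even lam w a.+1.
  move=> aS; have g0 := mass_norm_gt0 (ltnW aS); have g1 := mass_norm_gt0 aS.
  rewrite /a_even /off_coef /=.
  have m0 : mass != 0 by apply: contraTneq g0 => ->; rewrite mul0r ltxx.
  have -> : <<P a.+1, P a.+1>> / <<P a, P a>> =
     (mass * <<P a.+1, P a.+1>>) / (mass * <<P a, P a>>).
    by rewrite -mulf_div divff// mul1r.
  rewrite (sqrtrM _ (ltW g1)) (sqrtrV (ltW g0)).
  rewrite -{1}(sqr_sqrtr (ltW g1)).
  by field; rewrite !gt_eqF ?sqrtr_gt0.
rewrite mxE; case: eqVneq => [->|ij].
  rewrite -expr2 sqr_sqrtr ?ltW ?mass_norm_gt0// /a_odd /diag_coef -ip_mulX.
  rewrite -mulf_div divff ?mul1r//; have := mass_norm_gt0 (ltn_ord j).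
  by apply: contraTneq => ->; rewrite mul0r ltxx.
case: eqP => [ji|ji].
  by have jS := ltn_ord j; rewrite ji in jS *; rewrite next// nextE.
case: eqP => [ij'|ij'].
  have iS := ltn_ord i; rewrite ij' in iS *.
  by rewrite ip_mulX ipC next// [X in _ / X]mulrC nextE.
move: ij; rewrite -val_eqE /= neq_ltn => /orP[lt|lt].
  rewrite off ?ltn_ord ?mulr0 ?mul0r// ltn_neqAle lt andbT.
  by apply/eqP => E; exact: ji.
rewrite ip_mulX ipC off ?ltn_ord ?mulr0 ?mul0r// ltn_neqAle lt andbT.
by apply/eqP => E; exact: ij'.
Qed.

(** The polynomial of index 0 is constant, so the spectral measure of the first
    coordinate vector is the measure one started from. *)
Lemma eigenfun0_sqr : exists2 c : R, c != 0 &
  forall n, n \in S -> eigenfun 0 n ^+ 2 = c * coord w n.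
Proof.
have S0 : (0 < #|S|)%N by have [n nS _] := coordP w; apply/card_gt0P; exists n.
have g0 := mass_norm_gt0 S0.
exists (mass / (mass * <<P 0, P 0>>)).
  apply: mulf_neq0; last by rewrite invr_neq0// gt_eqF.
  by apply: contraTneq g0 => ->; rewrite mul0r ltxx.
move=> n nS; rewrite /eigenfun hornerE mul1r expr_div_n !sqr_sqrtr ?ltW//.
  by rewrite mulrAC.
exact: mass_coord_gt0.
Qed.

End OrthogonalPolynomials.

(** * Direct sums of Jacobi matrices *)

(** Here [u i j n] is meant to be the [n]-th eigencoordinate of the [j]-th basis
    vector of block [i]. *)
Section Glue.
Context {R : realType} {d : nat} (lam : 'I_d -> R) (s : ordpart d).
Variable u : 'I_(size (val s)) -> nat -> 'I_d -> R.
Local Notation blk := (nth finset.set0 (val s)).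
Local Notation bs := (fun i : 'I_(size (val s)) => #|blk i|).
Implicit Types i : 'I_(size (val s)).

Lemma block_disjoint (i j : nat) n : n \in blk i -> n \in blk j -> i = j.
Proof.
have [si|si] := ltnP i (size (val s)); last by rewrite nth_default ?inE.
have [sj|sj] := ltnP j (size (val s)); last by rewrite [blk j]nth_default ?inE.
have /and3P[_ /(pairwiseP finset.set0) dis _] := valP s => ni nj.
have [ij|ji|//] := ltngtP i j.
  by have := fintype.disjointFr (dis i j si sj ij) ni; rewrite nj.
by have := fintype.disjointFr (dis j i sj si ji) nj; rewrite ni.
Qed.

Lemma block_cover n : exists i, n \in blk i.
Proof.
have /and3P[_ _ /eqP/setP/(_ n)] := valP s.
rewrite inE finset.bigcup_seq => /finset.bigcupP[B /(nthP finset.set0)[i si <-] nB].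
by exists (Ordinal si).
Qed.

Lemma block_gt0 i : (0 < #|blk i|)%N.
Proof.
have /and3P[s0 _ _] := valP s.
by rewrite card_gt0; apply: contra s0 => /eqP <-; exact: mem_nth.
Qed.

Definition block_pos i (j : 'I_#|blk i|) : 'I_d :=
  cast_ord (ordpart_card s) (tagnat.Rank (p_ := bs) i j).

Definition block_fun i (j : nat) n : R := if n \in blk i then u i j n else 0.

Definition glue : 'M[R]_d :=
  \matrix_(n, a)
    let t := tagnat.sig (p_ := bs) (cast_ord (esym (ordpart_card s)) a) in
    block_fun (tag t) (tagged t) n.

Lemma glueE n i j : glue n (@block_pos i j) = block_fun i j n.
Proof. by rewrite mxE /block_pos cast_ordK /tagnat.Rank tagnat.rankK. Qed.

Lemma block_posP a : exists i j, a = @block_pos i j.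
Proof.
pose t := cast_ord (esym (ordpart_card s)) a.
exists (tagnat.sig1 (p_ := bs) t), (tagnat.sig2 (p_ := bs) t).
by rewrite /block_pos tagnat.sig2K /t cast_ordKV.
Qed.

Lemma block_pos_val i (j : 'I_#|blk i|) :
  block_pos j = (\sum_(k < size (val s) | (k < i)%N) #|blk k| + j)%N :> nat.
Proof. exact: (tagnat.RankEsum (p_ := bs)). Qed.

Lemma block_pos_lt i i' j j' : (i < i')%N -> (@block_pos i j < @block_pos i' j')%N.
Proof.
move=> ii; rewrite ltnNge /=; apply/negP => le.
have := @tagnat.le_sig1 _ bs (tagnat.Rank (p_ := bs) i' j') (tagnat.Rank (p_ := bs) i j) le.
by rewrite !tagnat.Rank1K leEord leqNgt ii.
Qed.

Lemma block_pos_lt_inner i (j j' : 'I_#|blk i|) :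
  (j < j')%N -> (block_pos j < block_pos j')%N.
Proof. by move=> jj; rewrite !block_pos_val ltn_add2l. Qed.

(** Stated as an elimination principle because the size of a block, hence the
    type of the offset [j'], depends on the block. *)
Lemma mxdiag_block_pos (B : forall i, 'M[R]_(#|blk i|)) (P : R -> Prop) i i' j j' :
  (i != i' -> P 0) ->
  (forall e : i = i', P (B i j (cast_ord (congr1 bs (esym e)) j'))) ->
  P (castmx (ordpart_card s, ordpart_card s) (\mxdiag_k B k)
    (@block_pos i j) (@block_pos i' j')).
Proof.
move=> P0 PB; rewrite castmxE !cast_ordK.
have -> : (\mxdiag_k B k) (tagnat.Rank (p_ := bs) i j) (tagnat.Rank (p_ := bs) i' j')
  = submxblock (\mxdiag_k B k) i i' j j' by rewrite /submxblock [RHS]mxE.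
rewrite /mxdiag mxblockK; have [ii|ii] := eqVneq i i'; last first.
  by rewrite mxE; apply: P0.
subst i'; rewrite conform_mx_id; have := PB erefl.
by rewrite (_ : cast_ord _ _ = j')//; exact: val_inj.
Qed.

Lemma block_fun_sum (h : 'I_d -> R) i (j j' : nat) :
  \sum_n h n * block_fun i j n * block_fun i j' n =
  \sum_(n in blk i) h n * u i j n * u i j' n.
Proof.
rewrite [RHS]big_mkcond; apply: eq_bigr => n _ /=; rewrite /block_fun.
by case: ifP; rewrite ?mulr0.
Qed.

Lemma block_fun_sum0 (h : 'I_d -> R) i i' (j j' : nat) :
  i != i' -> \sum_n h n * block_fun i j n * block_fun i' j' n = 0.
Proof.
move=> ii; apply: big1 => n _; rewrite /block_fun.
case: ifP => [ni|]; last by rewrite mulr0 mul0r.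
case: ifP => [ni'|]; last by rewrite mulr0.
by case/negP: ii; apply/eqP/val_inj; exact: block_disjoint ni ni'.
Qed.

Lemma with_eigenbasis_glue (B : forall i, 'M[R]_(#|blk i|)) :
  (forall i j j', B i j j' = \sum_(n in blk i) lam n * u i j n * u i j' n) ->
  with_eigenbasis lam glue = castmx (ordpart_card s, ordpart_card s) (\mxdiag_k B k).
Proof.
move=> BE; apply/matrixP => a b; rewrite with_eigenbasisE.
have [i [j ->]] := block_posP a; have [i' [j' ->]] := block_posP b.
under eq_bigr do rewrite !glueE.
apply: (@mxdiag_block_pos B (fun v => _ = v)); first exact: block_fun_sum0.
by move=> e; subst i'; rewrite block_fun_sum BE.
Qed.

Hypothesis u_orthonormal : forall i (j j' : 'I_#|blk i|),
  \sum_(n in blk i) u i j n * u i j' n = (j == j')%:R.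
Hypothesis u0_neq0 : forall i n, n \in blk i -> u i 0 n != 0.

Lemma glue_orthogonal : orthogonal glue.
Proof.
apply: mulmx1C; apply/matrixP => a b.
have [i [j ->]] := block_posP a; have [i' [j' ->]] := block_posP b.
rewrite [LHS]mxE [RHS]mxE.
under eq_bigr do rewrite mxE !glueE -[X in X * _]mul1r.
rewrite -[_ == _]val_eqE [X in (nat_of_bool X)%:R](tagnat.eq_Rank (p_ := bs)).
have [ii|ii] /= := eqVneq i i'; last by rewrite (block_fun_sum0 (fun=> 1)).
subst i'; rewrite (block_fun_sum (fun=> 1)).
by under eq_bigr do rewrite mul1r; rewrite u_orthonormal.
Qed.

Definition block_first i : 'I_d := @block_pos i (Ordinal (block_gt0 i)).

Lemma glue_first_neq0 i n : n \in blk i -> glue n (block_first i) != 0.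
Proof. by move=> ni; rewrite glueE /block_fun ni u0_neq0. Qed.

(** The first basis vector of a block has no zero eigencoordinate in its block.
    It thus forces every block to lie on one side, before [k] and outside [S]
    or from [k] on and inside [S], and prevents [k] from being interior to a
    block. *)
Lemma glue_lead (k : 'I_d) (S : {set 'I_d}) :
  (forall n (a : 'I_d), n \in S -> (a < k)%N -> glue n a = 0) ->
  (forall n (a : 'I_d), n \notin S -> (k <= a)%N -> glue n a = 0) ->
  exists i, k = block_first i /\
    forall n i', n \in blk i' -> (n \in S) = (i <= i')%N.
Proof.
move=> lo hi; have [i [j kE]] := block_posP k.
have j0 : (j : nat) = 0%N.
  apply/eqP; rewrite eqn0Ngt; apply/negP => j0.
  have [n Qn] := orthogonal_col_neq0 k glue_orthogonal.
  have ni : n \in blk i.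
    by apply: contraNT Qn => ni; rewrite kE glueE /block_fun (negbTE ni).
  have nS : n \notin S.
    apply/negP => nS; have := glue_first_neq0 ni.
    by rewrite lo ?eqxx// kE block_pos_lt_inner.
  by rewrite hi ?eqxx in Qn.
have {j j0}kE : k = block_first i by rewrite kE; congr block_pos; exact: val_inj.
exists i; split=> // n i' ni'.
have [ii|ii] := leqP i i'; last first.
  apply/negbTE/negP => nS; have := glue_first_neq0 ni'.
  by rewrite lo ?eqxx// kE block_pos_lt.
apply: contraT => nS; have := glue_first_neq0 ni'.
rewrite hi ?eqxx//; move: ii; rewrite leq_eqVlt => /orP[/eqP/val_inj <-|ii].
  by rewrite kE.
by rewrite kE ltnW// block_pos_lt.
Qed.

End Glue.

Section DbarBasis.
Context {R : realType} {d : nat} (lam : 'I_d -> R) (lam_inj : injective lam).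
Variable x : Dbar R d.
Local Notation blk := (nth finset.set0 (val (projT1 x))).

Definition dbar_eigenfun (i : 'I_(size (val (projT1 x)))) : nat -> 'I_d -> R :=
  eigenfun lam (val (projT2 x i)).

Definition dbar_basis : 'M[R]_d := glue dbar_eigenfun.

Lemma dbar_coord_gt0 (i : 'I_(size (val (projT1 x)))) m n :
  m \in blk i -> n \in blk i ->
  0 < coord (val (projT2 x i)) m * coord (val (projT2 x i)) n.
Proof. by have /asboolP H := valP (projT2 x i); exact: H. Qed.

Lemma dbar_eigenfun_orthonormal (i : 'I_(size (val (projT1 x)))) (j j' : 'I_#|blk i|) :
  \sum_(n in blk i) dbar_eigenfun i j n * dbar_eigenfun i j' n = (j == j')%:R.
Proof. by apply: eigenfun_orthonormal => //; exact: dbar_coord_gt0. Qed.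

Lemma dbar_eigenfun0_sqr (i : 'I_(size (val (projT1 x)))) : exists2 c : R, c != 0 & forall n, n \in blk i ->
  dbar_eigenfun i 0 n ^+ 2 = c * coord (val (projT2 x i)) n.
Proof. by apply: eigenfun0_sqr => //; exact: dbar_coord_gt0. Qed.

Lemma dbar_eigenfun0_neq0 (i : 'I_(size (val (projT1 x)))) n : n \in blk i -> dbar_eigenfun i 0 n != 0.
Proof.
move=> ni; have [c c0 E] := dbar_eigenfun0_sqr i.
rewrite -sqrf_eq0 E// mulf_neq0//; apply: contraTneq (dbar_coord_gt0 ni ni) => ->.
by rewrite mul0r ltxx.
Qed.

Lemma dbar_basis_orthogonal : orthogonal dbar_basis.
Proof. exact/glue_orthogonal/dbar_eigenfun_orthonormal. Qed.

Lemma dbar_basis_fbar : with_eigenbasis lam dbar_basis = fbar lam x.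
Proof.
apply: with_eigenbasis_glue => i j j'.
by apply: eigenfun_f => //; exact: dbar_coord_gt0.
Qed.

Lemma f_tridiagonal S (w : W R S) (i j : 'I_#|S|) :
  (i.+1 < j)%N || (j.+1 < i)%N -> f lam w i j = 0.
Proof.
have H (a b : nat) : (a.+1 < b)%N || (b.+1 < a)%N ->
  [/\ a == b = false, b == a.+1 = false & a == b.+1 = false].
  by move=> far; split; lia.
by move=> /H[h1 h2 h3]; rewrite mxE -val_eqE /= h1 h2 h3.
Qed.

Lemma f_offdiag_ge0 S (w : W R S) (i j : 'I_#|S|) :
  j = i.+1 :> nat -> 0 <= f lam w i j.
Proof.
by move=> ji; rewrite mxE -val_eqE /= ji eqxx ltn_eqF//; exact: sqrtr_ge0.
Qed.

Lemma fbar_tridiagonal : tridiagonal (fbar lam x).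
Proof.
move=> a b; have [i [j ->]] := block_posP (projT1 x) a; have [i' [j' ->]] := block_posP (projT1 x) b.
move=> far; apply: (@mxdiag_block_pos _ _ _
  (fun i => f lam (val (projT2 x i))) (fun v => v = 0)) => // e; subst i'; apply: f_tridiagonal.
by move: far; rewrite !block_pos_val /=; lia.
Qed.

Lemma fbar_offdiag_ge0 : nonneg_offdiag (fbar lam x).
Proof.
move=> a b; have [i [j ->]] := block_posP (projT1 x) a; have [i' [j' ->]] := block_posP (projT1 x) b.
move=> next; apply: (@mxdiag_block_pos _ _ _
  (fun i => f lam (val (projT2 x i))) (fun v => 0 <= v)) => // e; subst i'; apply: f_offdiag_ge0.
by move: next; rewrite !block_pos_val /=; lia.
Qed.

End DbarBasis.

Section PiBasis.
Context {R : realType} {d : nat} (lam : 'I_d -> R) (lam_inj : injective lam).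
Variables (w : Wprod R d) (Bw : BLam lam w).

(** The set [phi w n] is the largest one where [n] has a nonzero coordinate,
    and it is the [j]-th member of the chain. *)
Lemma wcoord_chain_lower i j n : n \in nth finset.set0 (blocks w) j ->
  (i < j)%N -> wcoord w (nth finset.set0 (chain w) i) n = 0.
Proof.
move=> nj ij; apply/eqP; apply: contraT => wn.
have jr : (j < size (chain w))%N.
  by rewrite -size_blocks ltnNge; apply/negP => le; rewrite nth_default ?inE in nj.
have ir := ltn_trans ij jr.
have [m mi mj] := chain_proper lam_inj Bw ij ir.
have nK : n \in nth finset.set0 (chain w) i.
  have: n \in nth finset.set0 (chain w) j.
    by move: nj; rewrite nth_blocks inE => /andP[].
  by apply/fintype.subsetP/(chain_sub lam_inj Bw)/ltnW.
have := fintype.subsetP (phi_max lam_inj Bw nK wn) m mi.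
by rewrite (blocks_phi lam_inj Bw nj) (negbTE mj).
Qed.

Lemma mem_chain_blocks i j n : n \in nth finset.set0 (blocks w) j ->
  (n \in nth finset.set0 (chain w) i) = (i <= j)%N.
Proof.
rewrite nth_blocks inE => /andP[nj1 nj]; apply/idP/idP => [ni|ij].
  rewrite leqNgt; apply: contra nj1 => ji.
  exact: (fintype.subsetP (chain_sub lam_inj Bw ji)).
exact: (fintype.subsetP (chain_sub lam_inj Bw ij)).
Qed.

(** By [glue_lead], the relevant sets [S] are the members of the chain of [w].
    On [K_i] the coordinates of [w] are those of the block [S_i], extended by
    zero, and the spectral measure of the first vector of this block is the
    same. *)
Lemma pi_lead_compatible :
  lead_compatible (wcoord w) (dbar_basis lam (pi_of lam_inj Bw)).
Proof.
set x := pi_of lam_inj Bw => k S lo hi.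
have [i [kE Si]] := glue_lead (@dbar_eigenfun_orthonormal _ _ _ lam_inj x)
  (@dbar_eigenfun0_neq0 _ _ _ lam_inj x) lo hi.
have SE : S = nth finset.set0 (chain w) i.
  apply/setP => n; have [i' ni'] := block_cover (projT1 x) n.
  by rewrite (Si n i' ni') (mem_chain_blocks _ ni').
suff [c E] : exists c : R, forall n, n \in S ->
    dbar_basis lam x n k ^+ 2 = c * wcoord w S n.
  by move=> a b aS bS; rewrite !E//; ring.
have [c c0 F] := dbar_eigenfun0_sqr lam_inj i.
have [e e0 G] := coord_mkW (blocks_neq0 lam_inj Bw (ltn_ord i)).
exists (c * e) => n nS; have [i' ni'] := block_cover (projT1 x) n.
have : (i <= i')%N by rewrite -(Si n i' ni').
rewrite leq_eqVlt => /orP[/eqP/val_inj E|ii].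
  subst i'; rewrite kE glueE /block_fun ni' F// SE -mulrA; congr (_ * _).
  exact: G.
rewrite SE (wcoord_chain_lower ni' ii) mulr0 kE glueE /block_fun.
case: ifP => [ni|_]; last by rewrite expr0n.
by have E := block_disjoint ni ni'; rewrite -E ltnn in ii.
Qed.

End PiBasis.

Local Open Scope classical_set_scope.
Local Open Scope quotient_scope.

(** * Ultrafilter limits and convex hulls of finite sets *)

(** A cluster point of the image of an ultrafilter is a limit, since the
    preimage of a neighbourhood or its complement belongs to the
    ultrafilter. *)
Lemma ultra_cvg_compact (T : Type) (Y : topologicalType) (U : set_system T)
    (f : T -> Y) (K : set Y) :
  UltraFilter U -> compact K -> (forall t, K (f t)) -> exists l : Y, f @ U --> l.
Proof.
move=> UU cK fK; have PU := ultra_proper.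
have fUK : (f @ U) K by apply: (@filterE _ U) => t; exact: fK.
have [l [_ cl]] := cK (f @ U) _ fUK.
exists l => V lV; have [//|UV] := in_ultra_setVsetC (f @^-1` V) UU.
by have [y [nVy Vy]] := cl (~` V) V UV lV.
Qed.

(** Otherwise the neighbourhoods of [x], traced on the preimage of the complement
    of a neighbourhood of [f x], would lie in some ultrafilter. *)
Lemma continuous_ultra (X Y : topologicalType) (f : X -> Y) :
  (forall x (U : set_system X), UltraFilter U -> U --> x -> f @ U --> f x) ->
  continuous f.
Proof.
move=> H x V fV; apply: contrapT => nV.
have PF : ProperFilter (within (~` (f @^-1` V)) (nbhs x)).
  split; last exact: within_filter.
  move=> W; apply: nV; change (nbhs x (f @^-1` V)).
  have {}W : nbhs x [set y | (~` (f @^-1` V)) y -> set0 y] by [].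
  by apply: filterS W => y /= Wy; apply: contrapT => /Wy.
have [U [UU FU]] := ultraFilterLemma PF.
have PU := @ultra_proper _ U UU.
have Ux : U --> x by move=> W xW; apply: FU; apply: filterS xW => y Wy _.
have UV : U (f @^-1` V) by exact: (H x U UU Ux).
have UnV : U (~` (f @^-1` V)) by apply: FU; exact: withinT.
have : U set0 by apply: filterS (filterI UV UnV) => y [Vy]; exact.
exact: filter_not_empty.
Qed.

Lemma cvg_sum_fin (T : Type) (F : set_system T) {FF : Filter F} (R : realType)
    (I : Type) (r : seq I) (P : pred I) (f : I -> T -> R) (l : I -> R) :
  (forall i, f i @ F --> l i) ->
  (fun t => \sum_(i <- r | P i) f i t) @ F --> \sum_(i <- r | P i) l i.
Proof.
by move=> fl; apply: cvg_big => [|i _]; [exact: add_continuous|exact: fl].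
Qed.

Lemma cvg_matrix (T : Type) (F : set_system T) {FF : Filter F} (R : realType)
    m n (f : T -> 'M[R]_(m, n)) (A : 'M[R]_(m, n)) :
  (forall i j, (fun t => f t i j) @ F --> A i j) -> f @ F --> A.
Proof.
move=> fA V [P AP PV]; near=> t; apply: PV.
by near: t; apply: filter_forall => i; apply: filter_forall => j; exact: fA.
Unshelve. all: by end_near. Qed.

Section ConvexHull.
Context {R : realType} {M : normedModType R}.

(** Iterated join with a point: each stage is the image under a continuous map
    of a segment times the previous stage, which makes compactness immediate.
    The starting point [x0] keeps the hull nonempty. *)
Fixpoint hull (x0 : M) (s : seq M) : set M :=
  if s is x :: s' then
    [set p.1 *: x + (1 - p.1) *: p.2 | p in `[0, 1] `*` hull x0 s']
  else [set x0].

Lemma hull_compact x0 s : compact (hull x0 s).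
Proof.
elim: s => [|x s IH] /=; first exact: compact_set1.
apply: (@continuous_compact (R * M)%type M
  (fun p => p.1 *: x + (1 - p.1) *: p.2)); last first.
  by apply: compact_setX => //; exact: segment_compact.
apply: continuous_subspaceT => p.
apply: cvgD; first by apply: cvgZ; [exact: cvg_fst|exact: cvg_cst].
by apply: cvgZ; [apply: cvgB; [exact: cvg_cst|exact: cvg_fst]|exact: cvg_snd].
Qed.

Lemma hull_mem x0 s x : x \in x0 :: s -> hull x0 s x.
Proof.
elim: s x => [|y s IH] x /=; first by rewrite inE => /eqP.
move=> xs; have : (x == y) || (x \in x0 :: s) by move: xs; rewrite !inE orbCA.
case/orP=> [/eqP->|/IH sx].
  exists (1, x0); last by rewrite /= subrr scale0r addr0 scale1r.
  by split=> /=; [rewrite in_itv /= ler01 lexx|apply: IH; rewrite inE eqxx].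
exists (0, x); last by rewrite /= subr0 scale0r add0r scale1r.
by split=> //=; rewrite in_itv /= ler01 lexx.
Qed.

Definition convexity (A : set M) := forall x y (t : R), A x -> A y ->
  0 <= t -> t <= 1 -> A (t *: x + (1 - t) *: y).

(** Regrouping the coefficients of [z], the rest is [p *: u + q *: v], that is
    [p + q] times a point of the previous stage unless [p + q] is zero. *)
Lemma hull_convex x0 s : convexity (hull x0 s).
Proof.
elim: s => [|z s IH] /= x y t.
  by move=> -> -> _ _; rewrite -scalerDl subrKC scale1r.
move=> [[a u] /= [/= + su] <-] [[b v] /= [/= + sv] <-] t0 t1.
rewrite !in_itv /= => /andP[a0 a1] /andP[b0 b1].
set c := t * a + (1 - t) * b.
have t1' : 0 <= 1 - t by rewrite subr_ge0.
have c0 : 0 <= c by rewrite addr_ge0 ?mulr_ge0.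
pose p := t * (1 - a); pose q := (1 - t) * (1 - b).
have p0 : 0 <= p by rewrite mulr_ge0 ?subr_ge0.
have q0 : 0 <= q by rewrite mulr_ge0 ?subr_ge0.
have pq : 1 - c = p + q by rewrite /c /p /q; ring.
have c1 : c <= 1 by rewrite -subr_ge0 pq addr_ge0.
exists (c, if p + q == 0 then u else (p / (p + q)) *: u + (1 - p / (p + q)) *: v).
  split; first by rewrite /= in_itv /= c0.
  case: eqP => //= /eqP pq0; apply: IH => //.
    by rewrite divr_ge0// addr_ge0.
  by rewrite ler_pdivrMr ?mul1r ?lerDl// lt_neqAle eq_sym pq0 addr_ge0.
rewrite /= pq !scalerDr !scalerA addrACA -scalerDl -/c -/p -/q; congr (_ + _).
case: eqP => [/eqP|/eqP pq0].
  by rewrite paddr_eq0// => /andP[/eqP-> /eqP->]; rewrite !scale0r addr0 scale0r addr0.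
rewrite scalerDr !scalerA; congr (_ *: _ + _ *: _); by field.
Qed.

Lemma hull_sub x0 s (A : set M) : convexity A ->
  (forall x, x \in x0 :: s -> A x) -> hull x0 s `<=` A.
Proof.
move=> cA; elim: s => [|z s IH] /= sA x.
  by move=> ->; apply: sA; rewrite inE.
move=> [[t u] /= [/= + su] <-]; rewrite in_itv /= => /andP[t0 t1].
apply: cA => //; first by apply: sA; rewrite !inE eqxx orbT.
apply: IH su => y; rewrite inE => ys; apply: sA; rewrite !inE.
by case/orP: ys => [->//|->]; rewrite !orbT.
Qed.

End ConvexHull.

(** * Continuity in the weights *)

Section ProjectiveRatio.
Context {R : realType} {d : nat} (S : {set 'I_d}).

(** The entries of the orthogonal projector on a line are homogeneous of degree
    0, hence continuous on the projective space, while the coordinates of a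
    chosen representative need not be. *)
Definition proj_ratio (i j : 'I_d) (w : W R S) : R :=
  coord w i * coord w j / \sum_(n in S) coord w n ^+ 2.

Lemma coord_sqr_sum_neq0 (w : W R S) : \sum_(n in S) coord w n ^+ 2 != 0.
Proof.
have [n nS wn] := coordP w; rewrite gt_eqF// (bigD1 n)//= ltr_pwDl//.
  by rewrite exprn_even_gt0.
by apply: sumr_ge0 => m _; rewrite sqr_ge0.
Qed.

Let vcoord (n : 'I_d) (v : set_type (@nonzero_vecs R d S)) : R := oapp (val v) 0 (insub n).

Let vcoord_continuous n : continuous (vcoord n).
Proof.
rewrite /vcoord; case: (insub n) => [i|] v; last exact: (@cst_continuous _ R (0 : R) v).
have c1 : continuous (val : set_type (@nonzero_vecs R d S) -> vecs S).
  exact: initial_continuous.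
have c2 : continuous (fun u : @vecs R d S => u i : R).
  exact: (@proj_continuous _ (fun=> R) i).
exact: (continuous_comp (c1 v) (c2 _)).
Qed.

Lemma proj_ratio_continuous i j : continuous (proj_ratio i j).
Proof.
apply/quotient_continuous.
have cE v : exists2 c : R, c != 0 & forall n, coord (\pi_(W R S) v : W R S) n = c * vcoord n v.
  have : scaling (repr (\pi_(W R S) v : W R S)) v by apply/eqmodP; rewrite -/(W R S) reprK.
  move=> /asboolP[c c0 hc]; exists c => // n; rewrite /coord /vcoord.
  by case: (insub n) => [m|] /=; rewrite ?hc ?mulr0.
have v0 v : \sum_(n in S) vcoord n v ^+ 2 != 0.
  have [c c0 E] := cE v; have := coord_sqr_sum_neq0 (\pi_(W R S) v : W R S).
  under eq_bigr do rewrite E exprMn.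
  by rewrite -mulr_sumr mulf_eq0 negb_or => /andP[].
have -> : proj_ratio i j \o \pi_(W R S) =
    fun v => vcoord i v * vcoord j v / \sum_(n in S) vcoord n v ^+ 2.
  apply/funext => v /=; have [c c0 E] := cE v; rewrite /proj_ratio !E.
  rewrite [X in _ / X = _](_ : _ = c ^+ 2 * \sum_(n in S) vcoord n v ^+ 2).
    by field; rewrite c0 v0.
  by rewrite mulr_sumr; apply: eq_bigr => n _; rewrite E exprMn.
move=> v; have vc n := @vcoord_continuous n v.
apply: (cvgM (cvgM (vc i) (vc j))); apply: cvgV => //; apply: cvg_sum_fin => n.
exact: (cvgM (vc n) (vc n)).
Qed.

End ProjectiveRatio.

Section FbarContinuous.
Context {R : realType} {d : nat} (lam : 'I_d -> R) (lam_inj : injective lam).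

Lemma pi_deflated (w : Wprod R d) (Bw : BLam lam w) :
  deflated (wcoord w) (dbar_basis lam (pi_of lam_inj Bw)).
Proof.
apply: (lead_deflated lam_inj).
- by move=> S S0; exact: wcoordP.
- by move=> S T S0 ST i j iS jS; exact: (Bw.1).
- exact: dbar_basis_orthogonal.
- by rewrite dbar_basis_fbar//; exact: fbar_tridiagonal.
- exact: pi_lead_compatible.
Qed.

(** Both eigenvector matrices are tied to the same point of [BLam]. *)
Lemma deflated_fbar (w : Wprod R d) (Bw : BLam lam w) (Q : 'M[R]_d) :
  orthogonal Q -> tridiagonal (with_eigenbasis lam Q) ->
  nonneg_offdiag (with_eigenbasis lam Q) -> deflated (wcoord w) Q ->
  fbar lam (pi_of lam_inj Bw) = with_eigenbasis lam Q.
Proof.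
move=> QQ tQ nQ dQ; rewrite -(dbar_basis_fbar lam_inj).
apply: (@deflated_unique _ _ lam (wcoord w)) => //.
- by move=> S S0; exact: wcoordP.
- exact: dbar_basis_orthogonal.
- by rewrite dbar_basis_fbar//; exact: fbar_tridiagonal.
- by rewrite dbar_basis_fbar//; exact: fbar_offdiag_ge0.
- exact: pi_deflated.
Qed.

Lemma wcoord_ratio_cvg (U : set_system (set_type (BLam lam)))
    (w0 : set_type (BLam lam)) (S : {set 'I_d}) (i j : 'I_d) :
  UltraFilter U -> U --> w0 -> S != finset.set0 ->
  (fun w => wcoord (val w) S i * wcoord (val w) S j /
            \sum_(n in S) wcoord (val w) S n ^+ 2) @ U -->
  (wcoord (val w0) S i * wcoord (val w0) S j /
            \sum_(n in S) wcoord (val w0) S n ^+ 2).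
Proof.
move=> UU Uw S0.
pose F (w : set_type (BLam lam)) := proj_ratio i j (val w (exist _ S S0)).
have FE w : F w = wcoord (val w) S i * wcoord (val w) S j /
            \sum_(n in S) wcoord (val w) S n ^+ 2.
  by rewrite /F /proj_ratio /wcoord insubT.
suff : F @ U --> F w0.
  by rewrite FE; apply: cvg_trans; apply: near_eq_cvg; apply: nearW => w; rewrite FE.
have c1 : continuous (val : set_type (BLam lam) -> Wprod R d).
  exact: initial_continuous.
have c2 : continuous (fun u : Wprod R d => u (exist _ S S0) : W R S).
  exact: (@proj_continuous _ (fun T : {T : {set 'I_d} | T != finset.set0} => W R (val T))
           (exist _ S S0)).
move=> A FA; apply: Uw.
exact: (continuous_comp (c1 w0)
  (continuous_comp (c2 _) (@proj_ratio_continuous _ _ S i j _))).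
Qed.

Lemma sqr_sum1_bound (I : finType) (y : I -> R) i :
  \sum_n y n ^+ 2 = 1 -> -1 <= y i <= 1.
Proof.
move=> y1; rewrite -ler_norml -(@ler_pXn2r _ 2) ?nnegrE//.
rewrite expr1n -normrX ger0_norm ?sqr_ge0// -y1 (bigD1 i)//= lerDl.
by apply: sumr_ge0 => n _; rewrite sqr_ge0.
Qed.

(** Along an ultrafilter converging to [w0], the eigenvector matrices and the
    vectors that witness [deflated] converge, their entries being bounded.
    The limits witness [deflated] for [w0], and [deflated_fbar] identifies the
    limit of the matrices. *)
Lemma fbar_continuous : continuous (fun w => fbar lam (piLam lam_inj w)).
Proof.
apply: continuous_ultra => w0 U UU Uw0; have PU := ultra_proper.
pose Q w := dbar_basis lam (piLam lam_inj w).
have QQ w : orthogonal (Q w) by exact: dbar_basis_orthogonal.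
have QE w : with_eigenbasis lam (Q w) = fbar lam (piLam lam_inj w).
  exact: dbar_basis_fbar.
have /choice[Y HY] : forall w, exists y : {set 'I_d} -> 'I_d -> R,
    forall S, S != finset.set0 -> [/\ \sum_n y S n ^+ 2 = 1,
        forall n, n \notin S -> y S n = 0,
        forall l : 'I_d, (#|~: S| < l)%N -> \sum_n Q w n l * y S n = 0
      & forall i j, i \in S -> j \in S ->
        wcoord (val w) S i * y S j ^+ 2 = wcoord (val w) S j * y S i ^+ 2].
  move=> w; suff /choice[y Hy] : forall S : {set 'I_d}, exists y : 'I_d -> R,
    S != finset.set0 -> [/\ \sum_n y n ^+ 2 = 1,
        forall n, n \notin S -> y n = 0,
        forall l : 'I_d, (#|~: S| < l)%N -> \sum_n Q w n l * y n = 0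
      & forall i j, i \in S -> j \in S ->
        wcoord (val w) S i * y j ^+ 2 = wcoord (val w) S j * y i ^+ 2] by exists y.
  move=> S; have [->|S0] := eqVneq S finset.set0; first by exists (fun=> 0).
  by have [y Hy] := pi_deflated (set_mem (valP w)) S0; exists y.
have itv := @segment_compact R (-1) 1.
have /choice[Ql QlE] : forall na : 'I_d * 'I_d, exists l : R,
    (fun w => Q w na.1 na.2) @ U --> l.
  move=> [n a]; apply: (ultra_cvg_compact UU itv) => w; rewrite /= in_itv /=.
  apply: (@sqr_sum1_bound _ (fun a => Q w n a)).
  by under eq_bigr do rewrite expr2; rewrite orthogonal_row// eqxx.
pose L : 'M[R]_d := \matrix_(n, a) Ql (n, a).
have QL n a : (fun w => Q w n a) @ U --> L n a by rewrite mxE; exact: (QlE (n, a)).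
have lim_eq (F : set_type (BLam lam) -> R) c l : F @ U --> l -> (forall w, F w = c) -> l = c.
  move=> Fl Fc; apply: (@cvg_unique _ (@norm_hausdorff R R) (F @ U)) => //.
  by rewrite (_ : F = fun=> c); [exact: cvg_cst|apply/funext].
have LL : orthogonal L.
  apply/matrixP => m n; rewrite !mxE; under eq_bigr do rewrite [X in _ * X]mxE.
  apply: (lim_eq (fun w => \sum_a Q w m a * Q w n a)); last by move=> w; rewrite orthogonal_row.
  by apply: cvg_sum_fin => a; apply: cvgM; exact: QL.
have AL a b : (fun w => fbar lam (piLam lam_inj w) a b) @ U --> with_eigenbasis lam L a b.
  under eq_cvg do rewrite -QE with_eigenbasisE.
  rewrite with_eigenbasisE; apply: cvg_sum_fin => n.
  apply: cvgM; last exact: QL.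
  by apply: cvgM; [exact: cvg_cst|exact: QL].
suff E : fbar lam (piLam lam_inj w0) = with_eigenbasis lam L.
  by rewrite E; apply: cvg_matrix => a b; exact: AL.
apply: deflated_fbar => //.
- move=> a b far; apply: (lim_eq _ _ _ (AL a b)) => w; exact: fbar_tridiagonal.
- move=> a b ab; have := AL a b => /cvgP/limr_ge.
  rewrite (cvg_lim (@norm_hausdorff R R) (AL a b)); apply.
  by apply: nearW => w; exact: fbar_offdiag_ge0.
move=> S S0.
have /choice[yl ylE] : forall n, exists l : R, (fun w => Y w S n) @ U --> l.
  move=> n; apply: (ultra_cvg_compact UU itv) => w; rewrite /= in_itv /=.
  by apply: sqr_sum1_bound; have [] := HY w S S0.
have yl2 n : (fun w => Y w S n ^+ 2) @ U --> yl n ^+ 2.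
  by under eq_cvg do rewrite expr2; rewrite expr2; apply: cvgM; exact: ylE.
exists yl; split.
- apply: (lim_eq (fun w => \sum_n Y w S n ^+ 2)); first exact: cvg_sum_fin.
  by move=> w; have [] := HY w S S0.
- move=> n nS; apply: (lim_eq _ _ _ (ylE n)) => w.
  by have [_ H _ _] := HY w S S0; exact: H.
- move=> l Sl; apply: (lim_eq (fun w => \sum_n Q w n l * Y w S n)).
    by apply: cvg_sum_fin => n; apply: cvgM; [exact: QL|exact: ylE].
  by move=> w; have [_ _ H _] := HY w S S0; exact: H.
- (* Multiplying the relation by a coordinate [m] that does not vanish at [w0],
     and dividing by the squared norm, turns coordinates into continuous
     functions. *)
  move=> i j iS jS; have [m mS wm] := wcoordP (val w0) S0.
  have sum0 : \sum_(n in S) wcoord (val w0) S n ^+ 2 != 0.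
    rewrite gt_eqF// (bigD1 m)//= ltr_pwDl//; first by rewrite exprn_even_gt0.
    by apply: sumr_ge0 => n _; rewrite sqr_ge0.
  have := lim_eq _ 0 _ (cvgB (cvgM (@wcoord_ratio_cvg U w0 S i m UU Uw0 S0) (yl2 j))
    (cvgM (@wcoord_ratio_cvg U w0 S j m UU Uw0 S0) (yl2 i))).
  set s := \sum_(n in S) _ => H.
  have /H/eqP : forall w : set_type (BLam lam),
      wcoord (val w) S i * wcoord (val w) S m / (\sum_(n in S) wcoord (val w) S n ^+ 2)
        * Y w S j ^+ 2 -
      wcoord (val w) S j * wcoord (val w) S m / (\sum_(n in S) wcoord (val w) S n ^+ 2)
        * Y w S i ^+ 2 = 0.
    move=> w; have [_ _ _ /(_ i j iS jS) E] := HY w S S0.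
    set t := (X in _ / X); transitivity ((wcoord (val w) S i * Y w S j ^+ 2 -
       wcoord (val w) S j * Y w S i ^+ 2) * (wcoord (val w) S m / t)); first ring.
    by rewrite E subrr mul0r.
  rewrite subr_eq0 => /eqP E2.
  apply: (@mulIf _ (wcoord (val w0) S m / s)); first by rewrite mulf_neq0 ?invr_neq0.
  by move: E2; rewrite mulrAC -mulrA mulrACA => ->; ring.
Qed.

End FbarContinuous.

(** * Compactness, surjectivity and the homeomorphism *)

Lemma compact_set_type (X : topologicalType) (A : set X) :
  compact A -> compact [set: set_type A].
Proof.
move=> cA F PF _.
have FA : (val @ F) A by apply: (@filterE _ F) => x; exact: set_mem (valP x).
have [p [Ap cp]] := cA (val @ F) _ FA.
exists (exist _ p (mem_set Ap)); split=> // B V FB [W [[G oG GW] Wp WV]].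
have pG : nbhs p G.
  by apply: open_nbhs_nbhs; split=> //; move: Wp; rewrite -GW.
have FvB : (val @ F) (val @` B) by apply: (@filterS _ F) FB => x Bx; exists x.
have [_ [[x Bx <-] Gx]] := cp _ _ FvB pG.
by exists x; split=> //; apply: WV; rewrite -GW.
Qed.

Lemma hausdorff_set_type (X : topologicalType) (A : set X) :
  hausdorff_space X -> hausdorff_space (set_type A).
Proof.
move=> hX p q cl; apply: val_inj; apply: hX => B C pB qC.
have cval : continuous (val : set_type A -> X) by exact: initial_continuous.
by have [x [Bx Cx]] := cl _ _ (cval p _ pB) (cval q _ qC); exists (val x).
Qed.

(** Preimages of closed sets under the inverse are images of compact sets. *)
Lemma compact_hausdorff_homeomorphism (X Y : topologicalType) (f : X -> Y) :
  compact [set: X] -> hausdorff_space Y -> continuous f -> injective f ->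
  (forall y, exists x, f x = y) -> homeomorphism f.
Proof.
move=> cX hY cf fI /choice[g gK]; split=> //; exists g.
have fK : cancel f g by move=> x; apply: fI; rewrite gK.
split=> //; apply/continuous_closedP => A cA.
have -> : g @^-1` A = f @` A.
  apply/seteqP; split=> [y Ay|_ [x Ax <-]]; first by exists (g y).
  by rewrite /preimage /= fK.
apply: compact_closed => //; apply: continuous_compact.
  exact: continuous_subspaceT.
exact: subclosed_compact cA cX _.
Qed.

Section Permutahedron.
Context {R : realType} {d : nat}.

Lemma convex_setE (A : set 'rV[R]_d) : @convex_set R 'rV[R]_d A <-> convexity A.
Proof.
split=> cA x y t.
  move=> Ax Ay t0 t1; apply/set_mem.
  exact: (cA x y (Itv01 t0 t1) (mem_set Ax) (mem_set Ay)).
by move=> /set_mem Ax /set_mem Ay; apply/mem_set/cA => //; exact: le1.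
Qed.

Lemma Pd_compact : compact (@Pd R d).
Proof.
pose pts := [seq @perm_point R d s | s <- enum {perm 'I_d}].
pose x0 := @perm_point R d 1%g.
suff -> : @Pd R d = hull x0 pts by exact: hull_compact.
have ptsE x : x \in x0 :: pts <-> range (@perm_point R d) x.
  split=> [|[s _ <-]].
    rewrite inE => /orP[/eqP->|/mapP[s _ ->]]; first by exists 1%g.
    by exists s.
  by rewrite inE; apply/orP; right; apply/mapP; exists s; rewrite ?mem_enum.
apply/seteqP; split.
  apply: smallest_sub; first exact/convex_setE/hull_convex.
  by move=> x /ptsE; exact: hull_mem.
apply: hull_sub.
  move=> x y t Px Py t0 t1 A [cA sA].
  by move/convex_setE: (cA); apply=> //; [apply: Px|apply: Py].
by move=> x /ptsE xr; exact: sub_gen_smallest.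
Qed.

End Permutahedron.

Section SpectralTheorem.
Context {R : realType} {d : nat} (lam : 'I_d -> R) (lam_inj : injective lam).

(** Eigenvectors of a symmetric matrix for distinct eigenvalues are orthogonal,
    and here there are as many eigenvalues as coordinates. *)
Lemma simple_spectrum_eigenbasis (A : 'M[R]_d) :
  A^T = A -> (forall n, eigenvalue A (lam n)) ->
  exists2 Q, orthogonal Q & A = with_eigenbasis lam Q.
Proof.
move=> sA eA.
have /choice[v Hv] n : exists v : 'rV[R]_d, v *m A = lam n *: v /\ v *m v^T = 1%:M.
  have /eigenvalueP[v vA v0] := eA n.
  pose N := (v *m v^T) 0 0.
  have N0 : 0 < N.
    have [a va] : exists a, v 0 a != 0.
      apply/existsP; apply: contraT; rewrite negb_exists => /forallP H.
      case/negP: v0; apply/eqP/rowP => a; rewrite mxE; apply/eqP.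
      by have := H a; rewrite negbK.
    rewrite /N mxE (bigD1 a)//= mxE ltr_pwDl//; first by rewrite -expr2 exprn_even_gt0.
    by apply: sumr_ge0 => b _; rewrite mxE -expr2 sqr_ge0.
  pose c := (Num.sqrt N)^-1.
  have c2 : c * c * N = 1.
    by rewrite -expr2 exprVn sqr_sqrtr ?mulVf ?gt_eqF// ltW.
  exists (c *: v); split; first by rewrite -scalemxAl vA !scalerA mulrC.
  rewrite linearZ /= -scalemxAl -scalemxAr scalerA.
  by rewrite [v *m v^T]mx11_scalar -/N scale_scalar_mx c2.
pose Q : 'M[R]_d := \matrix_n v n.
have QE : Q *m A = diag_mx (\row_n lam n) *m Q.
  apply/row_matrixP => n; rewrite row_mul rowK (Hv n).1.
  by apply/rowP => a; rewrite mul_diag_mx !mxE.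
have vv n m : v n *m (v m)^T = ((n == m)%:R)%:M.
  have [<-|nm] := eqVneq n m; first by rewrite (Hv n).2.
  have E : lam n *: (v n *m (v m)^T) = lam m *: (v n *m (v m)^T).
    rewrite scalemxAl -(Hv n).1 scalemxAr -linearZ /= -(Hv m).1 trmx_mul sA.
    by rewrite mulmxA.
  have : (lam n - lam m) *: (v n *m (v m)^T) == 0 by rewrite scalerBl E subrr.
  rewrite scaler_eq0 subr_eq0 => /orP[/eqP/lam_inj nm'|/eqP->].
    by rewrite nm' eqxx in nm.
  by rewrite raddf0.
have QQ : orthogonal Q.
  apply/matrixP => n m; rewrite [RHS]mxE.
  have := congr1 (fun M : 'M[R]_1 => M 0 0) (vv n m); rewrite mxE [in RHS]mxE /= mulr1n.
  by move=> <-; rewrite mxE; apply: eq_bigr => a _; rewrite !mxE.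
exists Q => //; rewrite /with_eigenbasis -mulmxA -QE mulmxA.
by rewrite (mulmx1C QQ) mul1mx.
Qed.

End SpectralTheorem.

Section Signs.
Context {R : realType} {d : nat} (lam : 'I_d -> R) (lam_inj : injective lam).
Implicit Types e : signs (d := d).
Local Notation E := (@diag_sign R d).

Lemma diag_sign_sqr e : E e *m E e = 1%:M.
Proof.
rewrite /diag_sign mul_diag_mx; apply/matrixP => i j; rewrite !mxE.
by case: eqP => //= _; rewrite ?mulr0 // !mulr1n -signr_addb addbb.
Qed.

Lemma diag_signE e (A : 'M[R]_d) i j : (E e *m A *m E e) i j =
  (-1) ^+ (e : {ffun 'I_d -> bool}) i * A i j * (-1) ^+ (e : {ffun 'I_d -> bool}) j.
Proof. by rewrite /diag_sign mul_mx_diag mul_diag_mx !mxE. Qed.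

Lemma diag_sign_orthogonal e Q : orthogonal Q -> orthogonal (Q *m E e).
Proof.
move=> QQ; rewrite /orthogonal trmx_mul tr_diag_mx mulmxA -(mulmxA Q).
by rewrite -/(E e) diag_sign_sqr mulmx1.
Qed.

Lemma diag_sign_eigenbasis e Q :
  E e *m with_eigenbasis lam Q *m E e = with_eigenbasis lam (Q *m E e).
Proof. by rewrite /with_eigenbasis trmx_mul tr_diag_mx !mulmxA. Qed.

Lemma with_eigenbasis_TLam (Q : 'M[R]_d) : orthogonal Q ->
  tridiagonal (with_eigenbasis lam Q) -> TLam lam (with_eigenbasis lam Q).
Proof.
move=> QQ tQ; split; [exact: with_eigenbasis_sym|exact: tQ|].
exact: eigenvalue_with_eigenbasis.
Qed.

(** Conjugation by [s] multiplies the entry that links [k] to [k + 1] by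
    [s k * s (k + 1)]; the sign at [k] counts the negative entries before. *)
Lemma offdiag_signs (A : 'M[R]_d) : exists e, nonneg_offdiag (E e *m A *m E e).
Proof.
pose neg (k : nat) := [exists i : 'I_d, [exists j : 'I_d,
  [&& i == k :> nat, j == k.+1 :> nat & A i j < 0]]].
pose s (k : nat) := odd (\sum_(i < k) neg i).
exists ([ffun k : 'I_d => s k] : {ffun 'I_d -> bool}) => i j ji.
rewrite diag_signE !ffunE mulrAC -signr_addb.
have -> : s i (+) s j = neg i.
  by rewrite ji /s big_ord_recr /= oddD oddb addbA addbb.
have -> : neg i = (A i j < 0).
  apply/existsP/idP => [[i' /existsP[j' /and3P[/eqP ei /eqP ej]]]|Aij].
    have -> : i' = i by exact: val_inj.
    by have -> // : j' = j by apply: val_inj; rewrite /= ej ji.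
  by exists i; apply/existsP; exists j; rewrite eqxx ji eqxx.
case: ltP => Aij; first by rewrite expr1 mulN1r oppr_ge0 ltW.
by rewrite expr0 mul1r.
Qed.

End Signs.

Section Assembly.
Context {R : realType} {d : nat} {lam : 'I_d -> R} (lam_inj : injective lam).

(** A point of [BLam] tied to an eigenvector matrix of [A] has image [A], by
    uniqueness. *)
Lemma fbar_surjective (A : 'M[R]_d) : TLam lam A -> nonneg_offdiag A ->
  exists w : set_type (BLam lam), fbar lam (piLam lam_inj w) = A.
Proof.
move=> [sA tA eA] nA.
have [|Q QQ AE] := @simple_spectrum_eigenbasis _ _ lam lam_inj A sA.
  by move=> n; apply/eA; exists n.
have [w [Bw cw]] := weights_exist lam_inj QQ.
exists (exist _ w (mem_set Bw)); rewrite AE; rewrite AE in tA nA.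
apply: deflated_fbar => //=; apply: (lead_deflated lam_inj) => //.
  by move=> S S0; exact: wcoordP.
by move=> S T S0 ST i j iS jS; exact: (Bw.1).
Qed.

Variable h : set_type (@Pd R d) -> set_type (BLam lam).

Lemma g_TLam x : TLam lam (g lam_inj h x).
Proof.
rewrite /g /J -dbar_basis_fbar// diag_sign_eigenbasis; apply: with_eigenbasis_TLam.
  exact/diag_sign_orthogonal/dbar_basis_orthogonal.
rewrite -diag_sign_eigenbasis dbar_basis_fbar// => i j far.
by rewrite diag_signE fbar_tridiagonal ?mulr0 ?mul0r.
Qed.

Lemma g_continuous : continuous h -> continuous (g lam_inj h).
Proof.
move=> ch x; apply: cvg_matrix => i j; rewrite /g diag_signE.
under eq_cvg do rewrite diag_signE.
have cs k : continuous (fun x : set_type (@Pd R d) * signs (d := d) =>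
    (-1) ^+ (x.2 : {ffun 'I_d -> bool}) k : R).
  move=> y; apply: (@cvg_comp _ _ _ snd
    (fun e : signs => (-1) ^+ (e : {ffun 'I_d -> bool}) k : R) _ (nbhs y.2)).
    exact: cvg_snd.
  have y2 : nbhs y.2 [set y.2] := @discrete_set1 (discrete_topology {ffun 'I_d -> bool}) y.2.
  by apply: cvg_near_cst; apply: (filterS _ y2) => e ->.
have cJ : continuous (fun x : set_type (@Pd R d) * signs (d := d) =>
    J lam_inj h x.1 i j).
  move=> y; apply: (@cvg_comp _ _ _ fst (fun p => J lam_inj h p i j) _ (nbhs y.1)).
    exact: cvg_fst.
  exact: (continuous_comp (ch y.1)
    (continuous_comp (@fbar_continuous _ _ _ lam_inj _) (@coord_continuous _ _ _ i j _))).
exact: (cvgM (cvgM (cs i x) (cJ x)) (cs j x)).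
Qed.

Lemma g_repr_to_Pbar p e :
  g lam_inj h (repr (to_Pbar lam_inj h p e)) = g lam_inj h (p, e).
Proof.
apply/eqP; change (same_g lam_inj h (repr (to_Pbar lam_inj h p e)) (p, e)).
by apply/eqmodP; rewrite -/(Pbar lam_inj h) reprK.
Qed.

Lemma Pbar_compact : compact [set: Pbar lam_inj h].
Proof.
have -> : [set: Pbar lam_inj h] = \pi_(Pbar lam_inj h) @` [set: set_type (@Pd R d) * signs (d := d)].
  by apply/seteqP; split=> // q _; exists (repr q) => //; rewrite reprK.
apply: continuous_compact; first exact/continuous_subspaceT/pi_continuous.
rewrite -setXTT; apply: compact_setX; first exact/compact_set_type/Pd_compact.
by apply: finite_compact; exact: finite_finset.
Qed.

End Assembly.

Theorem theorem32 (R : realType) (d : nat) (d_gt0 : (0 < d)%N)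
    (lam : 'I_d -> R) (lam_inj : injective lam)
    (h : set_type (@Pd R d) -> set_type (BLam lam))
    (h_homeo : homeomorphism h)
    (h_faces : face_compatible lam_inj h) :
  exists gt : Pbar lam_inj h -> set_type (TLam lam),
    (forall p e, val (gt (to_Pbar lam_inj h p e)) = g lam_inj h (p, e)) /\
    homeomorphism gt.
Proof.
have [hc [h' [_ h'K _]]] := h_homeo.
pose gt (q : Pbar lam_inj h) : set_type (TLam lam) :=
  exist _ (g lam_inj h (repr q)) (mem_set (g_TLam lam_inj h (repr q))).
exists gt; split; first by move=> p e; exact: g_repr_to_Pbar.
apply: compact_hausdorff_homeomorphism.
- exact: Pbar_compact.
- exact/hausdorff_set_type/norm_hausdorff.
- apply: continuous_comp_initial; apply/quotient_continuous.
  have -> : (val \o gt) \o \pi_(Pbar lam_inj h) = g lam_inj h.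
    by apply/funext => -[p e]; exact: g_repr_to_Pbar.
  exact: g_continuous.
- move=> q q' /(congr1 val) /= E; rewrite -(reprK q) -(reprK q').
  by apply/eqmodP; rewrite /= /same_g E.
- move=> [A AT]; have TA := set_mem AT.
  have [e ne] := offdiag_signs A.
  have [sA tA eA] := TA.
  have [Q QQ AE] : exists2 Q, orthogonal Q & A = with_eigenbasis lam Q.
    by apply: simple_spectrum_eigenbasis => // n; apply/eA; exists n.
  have [|w wE] := @fbar_surjective _ _ _ lam_inj _ _ ne.
    rewrite AE diag_sign_eigenbasis; apply: with_eigenbasis_TLam.
      exact: diag_sign_orthogonal.
    rewrite -diag_sign_eigenbasis -AE => i j far.
    by rewrite diag_signE tA ?mulr0 ?mul0r.
  exists (to_Pbar lam_inj h (h' w) e); apply: val_inj.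
  rewrite [LHS]g_repr_to_Pbar /g /J /= h'K wE.
  by rewrite !mulmxA diag_sign_sqr mul1mx -mulmxA diag_sign_sqr mulmx1.
Qed.
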